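(* Let $p\ge 1$, let $\nu,\mu,\gamma>0$, and let $F:\mathbb R\to\mathbb R$ satisfy, for some constant $K>0$ and all $x,y\ge 0$, $$|F(x)-F(y)|\le K(|x|^{p-1}+|y|^{p-1})|x-y|,\qquad F(0)=0,\qquad |F'(x)|\le K|x|^{p-1}.$$ Consider on $\mathbb R$, with zero boundary conditions as $|x|\to\infty$, the integrable and non-integrable focusing NLS equations $$iu_t+\nu u_{xx}+\mu|u|^2u=0,\qquad iU_t+\nu U_{xx}+\gamma F(|U|^2)U=0,$$ with initial conditions $u(x,0)=u_0(x)$ and $U(x,0)=U_0(x)$, respectively. (i) ($L^2$ closeness) Given $0<\varepsilon<1$, suppose that $$\|u_0-U_0\|_{L^2(\mathbb R)}\le C\varepsilon^3,\qquad \|u_0\|_{H^1(\mathbb R)}\le c_0\varepsilon,\qquad \|U_0\|_{H^1(\mathbb R)}\le C_0\varepsilon$$ for some constants $c_0,C_0,C>0$. Then, for arbitrary finite time $0<T_f<\infty$, there exists a constant $\widetilde C=\widetilde C(\mu,\gamma,c_0,C_0,C,T_f)$ such that the corresponding solutions satisfy $$\sup_{t\in[0,T_f]}\|u(t)-U(t)\|_{L^2(\mathbb R)}\le\widetilde C\varepsilon^3.$$ (ii) ($H^1$ and $L^\infty$ closeness) If $\|u_0\|_{H^1(\mathbb R)}\le c_0\varepsilon$, $\|U_0\|_{H^1(\mathbb R)}\le C_0\varepsilon$ and, in place of the $L^2$ condition on the difference, the stronger condition $$\|u_0-U_0\|_{H^1(\mathbb R)}\le C_1\varepsilon^3$$ holds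 for some constant $C_1>0$, then there exists a constant $\widetilde C_1$, depending on $C_1$ and on $\mu,\gamma,c_0,C_0,T_f$, such that $$\sup_{t\in[0,T_f]}\|u(t)-U(t)\|_{H^1(\mathbb R)}\le\widetilde C_1\varepsilon^3.$$ Consequently, there exists a constant $\widetilde C_2$ with similar dependencies as $\widetilde C_1$ such that $$\sup_{t\in[0,T_f]}\|u(t)-U(t)\|_{L^\infty(\mathbb R)}\le\widetilde C_2\varepsilon^3.$$
   Context: The data $F$ (with $p,K$) and $\nu$ are regarded as fixed; the constants $\widetilde C,\widetilde C_1,\widetilde C_2$ do not depend on $\varepsilon$. The ''corresponding solutions'' are the global-in-time $H^1(\mathbb R)$ solutions of the two Cauchy problems provided by the known well-posedness theory, which the paper recalls: for $1\le p<2$ every $U_0\in H^1(\mathbb R)$, and for $p\ge2$ every $U_0\in H^1(\mathbb R)$ with $\|U_0\|_{H^1(\mathbb R)}\le\delta$ for a suitable $\delta>0$, gives rise to a global solution satisfying $\sup_{t\ge0}\|U(t)\|_{H^1(\mathbb R)}\le M\|U_0\|_{H^1(\mathbb R)}$ for a constant $M>0$ independent of $t$; the cubic equation is the case $p=1$. *)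

(* Defs.v *)
From HB Require Import structures.
From mathcomp Require Export all_boot all_order all_algebra.
From mathcomp.real_closed Require Export complex.
From mathcomp Require Export all_classical all_reals all_analysis.

Set Implicit Arguments.
Unset Strict Implicit.
Unset Printing Implicit Defensive.
Import Order.TTheory GRing.Theory Num.Theory ComplexField.
Import numFieldNormedType.Exports.
Local Open Scope classical_set_scope.
Local Open Scope complex_scope.
Local Open Scope ring_scope.

Section SobolevSpaces.
Context {R : realType}.
Local Notation leb := (@lebesgue_measure R).
Local Notation normc := (@Normc.normc R).
Implicit Types f g phi : R -> R[i].

Definition L2norm f : \bar R := 'N[leb]_2%:E[EFin \o normc \o f].

Definition Linftynorm f : \bar R := 'N[leb]_+oo[EFin \o normc \o f].

Definition L2 f : Prop :=
  [/\ measurable_fun setT (fun x => complex.Re (f x)),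
      measurable_fun setT (fun x => complex.Im (f x)) &
      (L2norm f < +oo)%E].

(* real-valued test functions of class C^1 with compact support *)
Definition C1c (chi : R -> R) : Prop :=
  [/\ forall x, derivable chi x 1,
      continuous (derive1 chi) &
      exists A : R, forall x, A < `|x| -> chi x = 0].

Definition weak_derivative f g : Prop :=
  forall chi : R -> R, C1c chi ->
    (\int[leb]_x (complex.Re (f x) * derive1 chi x) =
      - (\int[leb]_x (complex.Re (g x) * chi x))) /\
    (\int[leb]_x (complex.Im (f x) * derive1 chi x) =
      - (\int[leb]_x (complex.Im (g x) * chi x))).

(* Elements of H^1(R) vanish at infinity (for their continuous
   representative): this is how boundary conditions at infinity are encoded. *)
Definition H1 f : Prop := L2 f /\ exists g, L2 g /\ weak_derivative f g.

(* A chosen representative of the weak derivative of f, which is unique up to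
   almost everywhere equality; only meaningful when H1 f holds. *)
Definition Dx f : R -> R[i] :=
  xget (fun=> 0) [set g | L2 g /\ weak_derivative f g].

(* only meaningful when H1 f holds *)
Definition H1norm f : \bar R :=
  ((L2norm f ^+ 2 + L2norm (Dx f) ^+ 2) `^ 2^-1)%E.

(* \int f(x) \overline{phi(x)} dx *)
Definition L2dot f phi : R[i] :=
  (\int[leb]_x complex.Re (f x * (phi x)^*%C)) +i*
  (\int[leb]_x complex.Im (f x * (phi x)^*%C)).

(* H^{-1}(R) is the antidual of H^1(R); a function f in L^2(R) is identified
   with the functional L2dot f. *)
Definition Hm1norm (L : (R -> R[i]) -> R[i]) : \bar R :=
  ereal_sup [set (normc (L phi))%:E
            | phi in [set phi | H1 phi /\ (H1norm phi <= 1)%E]].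

End SobolevSpaces.

Arguments L2norm {R} f%_ring_scope.
Arguments Linftynorm {R} f%_ring_scope.
Arguments H1norm {R} f%_ring_scope.

Section Schroedinger.
Context {R : realType}.
Local Notation leb := (@lebesgue_measure R).
Local Notation normc := (@Normc.normc R).

(* u is a global solution of i u_t + nu u_xx + N(u) = 0, u(0) = u0, in
   C([0, +oo[, H^1(R)) \cap C^1([0, +oo[, H^{-1}(R)), u t being the function
   u(., t). The equation holds in H^{-1}(R) for all t >= 0, with
   <u_xx, phi> = - <u_x, phi_x>. *)
Definition global_H1_solution (nu : R) (N : R[i] -> R[i])
    (u0 : R -> R[i]) (u : R -> R -> R[i]) : Prop :=
  [/\ forall t, 0 <= t -> H1 (u t),
      forall t, 0 <= t ->
        H1norm (u s \- u t) @[s --> within [set s | 0 <= s] (nbhs t)] --> 0%E,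
      exists ut : R -> (R -> R[i]) -> R[i], forall t, 0 <= t ->
        [/\ Hm1norm (fun phi => (s - t)^-1%:C * L2dot (u s \- u t) phi - ut t phi)
              @[s --> within [set s | 0 <= s] t^'] --> 0%E,
            Hm1norm (fun phi => ut s phi - ut t phi)
              @[s --> within [set s | 0 <= s] (nbhs t)] --> 0%E &
            forall phi, H1 phi ->
              'i%C * ut t phi - nu%:C * L2dot (Dx (u t)) (Dx phi)
                + L2dot (fun x => N (u t x)) phi = 0] &
      {ae leb, forall x, u 0 x = u0 x}].

(* The solutions given by the global well-posedness theory: they satisfy
   sup_(t >= 0) ||u(t)||_{H^1} <= M ||u0||_{H^1}. *)
Definition bounded_global_H1_solution (M nu : R) (N : R[i] -> R[i])
    (u0 : R -> R[i]) (u : R -> R -> R[i]) : Prop :=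
  global_H1_solution nu N u0 u /\
  (ereal_sup [set H1norm (u t) | t in [set t | (0 <= t)%R]]
     <= M%:E * H1norm u0)%E.

Definition cubic_nonlinearity (mu : R) (z : R[i]) : R[i] :=
  (mu * normc z ^+ 2)%:C * z.

Definition general_nonlinearity (gamma : R) (F : R -> R) (z : R[i]) : R[i] :=
  (gamma * F (normc z ^+ 2))%:C * z.

End Schroedinger.

(* Main.v *)
(* Both parts are L^2 energy estimates for the linear flow i w_t + nu w_xx + f = 0
   satisfied by w = u - U, where f is the difference of the two nonlinear terms.
   Pairing the equation with w removes w_xx, so that ||w(t)|| grows at rate at most
   sup ||f||. Since the solutions are O(eps) in H^1(R), hence in L^oo(R), and both
   nonlinearities are Lipschitz with constant O(eps^2) on balls of radius O(eps),
   one has ||f|| = O(eps^3), which is the L^2 statement.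

   The equation only holds in H^-1(R), hence cannot be paired with w_xx to control
   w_x. Instead, the L^2 estimate is applied to the increment w(. + h) - w, which
   solves the same equation with forcing f(. + h) - f. The Lipschitz bound gives
   ||f(. + h) - f|| = O(eps^2) (||u(. + h) - u|| + ||U(. + h) - U||) = O(h eps^3)
   without differentiating the nonlinearities, so ||w(. + h) - w|| = O(h eps^3).
   Dividing by h and letting h tend to 0, Fatou's lemma gives ||w_x|| = O(eps^3).
   The bound in L^oo(R) follows by Sobolev embedding. *)
Require Import Defs.
From mathcomp Require Import measurable_realfun measure_function ess_sup_inf.
From mathcomp Require Import ring lra.
Import Order.TTheory GRing.Theory Num.Theory.
Import numFieldNormedType.Exports.
Local Open Scope classical_set_scope.
Local Open Scope ring_scope.

Set Implicit Arguments.
Unset Strict Implicit.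
Unset Printing Implicit Defensive.

(** The growth in time is linear because the a priori bound [M] keeps both solutions of size eps at
    all times: each nonlinear term is then by itself a forcing of size eps^3. As eps < 1 and p >= 1,
    F is Lipschitz on the relevant interval [0, m^2 eps^2] with a constant independent of eps, so
    F(|U|^2) U is at worst cubic; the integrable equation is the case F = id, p = 1. The time
    derivative exists only in H^-1(R). The squared norm is therefore differentiated by testing the
    increment w(s) - w(t) with w(s) and w(t), which stay bounded in H^1(R), and by using the real
    part of the pairing, for which multiplication by i is skew. Elements of H^1(R) are handled
    without choosing continuous representatives. The link between a function f and its weak
    derivative g is f(b) - f(a) = \int_a^b g at Lebesgue points a, b, obtained by testing with C^1
    steps. It yields the translation bound, the convergence of difference quotients, the uniqueness
    of g and the Sobolev bound. *)

(** * Translations *)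
Section translation.
Context {R : realType}.
Local Notation leb := (@lebesgue_measure R).
Implicit Types (h : R).

Let shift h : measurableTypeR R -> measurableTypeR R := fun x => x + h.

Let measurable_shift h : measurable_fun setT (shift h).
Proof.
have : measurable_fun setT (fun x : R => x + h) by exact: measurable_funD.
exact.
Qed.

(** Lebesgue measure is determined by its values on half-open intervals, and a shift pulls such an
    interval back to one of the same length. *)
Let pushforward_shift h (A : set (measurableTypeR R)) : measurable A ->
  leb A = pushforward leb (shift h) A.
Proof.
move=> mA.
pose m := measure_function_pushforward__canonical__measure_function_Measure leb
  (measurable_shift h).
apply: (lebesgue_measure_unique (mu := m)) mA => X [] [a b] /= _ <-.
rewrite /pushforward.
have -> : shift h @^-1` `]a, b]%classic = `]a - h, b - h]%classic.
  by apply/seteqP; split => x /=; rewrite !in_itv/= ltrBlDr lerBrDr.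
rewrite !lebesgue_measure_itv/= !lte_fin ltrBlDr subrK.
by case: ifPn => // _; rewrite -!EFinB opprB addrA subrK.
Qed.

Lemma ge0_integral_shift h (f : R -> \bar R) : measurable_fun setT f ->
  (forall x, 0 <= f x)%E -> (\int[leb]_x f (x + h)%R = \int[leb]_x f x)%E.
Proof.
move=> mf f0.
have := @ge0_integral_pushforward _ _ _ _ R _ (measurable_shift h)
  leb setT f measurableT mf.
move=> <-; last by move=> x _; exact: f0.
by apply: eq_measure_integral => A mA _; exact/esym/pushforward_shift.
Qed.

Lemma measurable_fun_shift d (T : measurableType d) h (f : R -> T) :
  measurable_fun setT f -> measurable_fun setT (fun x : R => f (x + h)).
Proof. by move=> mf; apply: measurableT_comp mf (measurable_shift h). Qed.

Lemma integrable_shift h (f : R -> \bar R) :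
  leb.-integrable setT f -> leb.-integrable setT (fun x : R => f (x + h)%R).
Proof.
move=> /integrableP[mf iff]; apply/integrableP; split.
  exact: measurable_fun_shift.
by rewrite (ge0_integral_shift h (f := fun x => `|f x|%E))//; exact: measurableT_comp.
Qed.

Lemma Rintegral_shift h (f : R -> R) : leb.-integrable setT (EFin \o f) ->
  \int[leb]_x f (x + h) = \int[leb]_x f x.
Proof.
move=> intf.
have mf : measurable_fun setT (EFin \o f) by case/integrableP : (intf).
have := @integral_pushforward _ _ _ _ R _ (measurable_shift h) leb setT (EFin \o f) mf
  (integrable_shift h intf) measurableT.
rewrite /Rintegral preimage_setT/= => <-; congr fine.
by apply: eq_measure_integral => A mA _; exact/esym/pushforward_shift.
Qed.

Lemma ae_shift h (P : set R) : (\forall x \ae leb, P x) ->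
  \forall x \ae leb, P (x + h).
Proof.
move=> [N [mN N0 PN]]; exists (shift h @^-1` N); split.
- by rewrite -[X in measurable X]setTI; exact: measurable_shift.
- by rewrite -N0; exact/esym/pushforward_shift.
- by move=> x /= Px; apply: PN.
Qed.

Lemma ae_imply (P Q : R -> Prop) : (forall x, P x -> Q x) ->
  (\forall x \ae leb, P x) -> \forall x \ae leb, Q x.
Proof. by move=> PQ; apply: filterS; first exact: (ae_filter_ringOfSetsType leb). Qed.

Lemma ae_imply2 (P Q S : R -> Prop) : (forall x, P x -> Q x -> S x) ->
  (\forall x \ae leb, P x) -> (\forall x \ae leb, Q x) -> \forall x \ae leb, S x.
Proof. by move=> PQ; apply: filterS2; first exact: (ae_filter_ringOfSetsType leb). Qed.

End translation.

(** * Square-integrable functions *)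
(** Discriminant argument behind the Cauchy-Schwarz inequality, shared by the real and the complex
    pairings. For [c > 0] the polynomial is evaluated at its minimum [- b / c]. *)
Lemma sqr_le_of_quadratic_ge0 (R : realFieldType) (a b c : R) : 0 <= c ->
  (forall t, 0 <= a + 2 * t * b + t ^+ 2 * c) -> b ^+ 2 <= a * c.
Proof.
rewrite le_eqVlt => /orP[/eqP <-|c0] H.
  have [->|b0] := eqVneq b 0; first by rewrite expr0n mulr0.
  (* With [c = 0] and [b != 0] the polynomial is affine and takes the value -1 at this point. *)
  have := H (- (a + 1) / (2 * b)).
  have -> : 2 * (- (a + 1) / (2 * b)) * b = - (a + 1) by field.
  by rewrite mulr0; lra.
have := H (- b / c).
have -> : a + 2 * (- b / c) * b + (- b / c) ^+ 2 * c = (a * c - b ^+ 2) / c.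
  by field; rewrite gt_eqF.
by rewrite pmulr_lge0 ?invr_gt0// subr_ge0.
Qed.

Section square_integrable.
Context {R : realType}.
Local Notation leb := (@lebesgue_measure R).
Implicit Types (f g k : R -> R) (h : R).

(** Measurability of [f] is a separate clause because integrability of the square says nothing about
    the sign of [f]. *)
Definition sqintegrable f :=
  measurable_fun setT f /\ leb.-integrable setT (EFin \o (fun x => f x ^+ 2)).

Definition dot f g : R := \int[leb]_x (f x * g x).

Lemma sqintegrable_mul f g : sqintegrable f -> sqintegrable g ->
  leb.-integrable setT (EFin \o (fun x => f x * g x)).
Proof.
move=> [mf f2] [mg g2].
apply: (@le_integrable _ _ _ leb setT measurableT _ (EFin \o (fun x => f x ^+ 2 + g x ^+ 2))) => //.
- by apply/measurable_EFinP; exact: measurable_funM.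
- move=> x _ /=; rewrite lee_fin [leRHS]ger0_norm ?addr_ge0 ?sqr_ge0//.
  by rewrite ler_norml; apply/andP; split; nra.
- exact: integrableD f2 g2.
Qed.

Lemma le_sqintegrable f g (C : R) : 0 <= C -> measurable_fun setT f -> sqintegrable g ->
  (forall x, `|f x| <= C * `|g x|) -> sqintegrable f.
Proof.
move=> C0 mf [mg g2] fg; split=> //.
apply: (@le_integrable _ _ _ leb setT measurableT _ (EFin \o (fun x => C ^+ 2 * g x ^+ 2))) => //.
- by apply/measurable_EFinP; exact: measurable_funX.
- move=> x _ /=; rewrite lee_fin [leRHS]normrM !normrX -exprMn lerXn2r ?nnegrE ?mulr_ge0//.
  by rewrite (ger0_norm C0).
- exact: (integrableZl measurableT (C ^+ 2) g2).
Qed.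

Lemma sqintegrableD f g : sqintegrable f -> sqintegrable g ->
  sqintegrable (fun x => f x + g x).
Proof.
move=> [mf f2] [mg g2]; split; first exact: measurable_funD.
apply: (@le_integrable _ _ _ leb setT measurableT _
   (EFin \o (fun x => (f x ^+ 2 + f x ^+ 2) + (g x ^+ 2 + g x ^+ 2)))) => //.
- by apply/measurable_EFinP/measurable_funX; exact: measurable_funD.
- move=> x _ /=; rewrite lee_fin [leLHS]ger0_norm ?sqr_ge0// [leRHS]ger0_norm ?addr_ge0 ?sqr_ge0//.
  by have := sqr_ge0 (f x - g x); nra.
- by apply: (integrableD measurableT (integrableD _ f2 f2) (integrableD _ g2 g2)).
Qed.

Lemma sqintegrableZ f (c : R) : sqintegrable f -> sqintegrable (fun x => c * f x).
Proof.
move=> f2; apply: (@le_sqintegrable _ f `|c|) => //.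
- by apply: measurable_funM => //; case: f2.
- by move=> x; rewrite normrM.
Qed.

Lemma sqintegrableN f : sqintegrable f -> sqintegrable (fun x => - f x).
Proof.
by move=> /(sqintegrableZ (-1)); under eq_fun do rewrite mulN1r.
Qed.

Lemma sqintegrableB f g : sqintegrable f -> sqintegrable g ->
  sqintegrable (fun x => f x - g x).
Proof. by move=> f2 /sqintegrableN g2; exact: sqintegrableD. Qed.

Lemma sqintegrable_shift h f : sqintegrable f -> sqintegrable (fun x => f (x + h)).
Proof.
move=> [mf f2]; split; first exact: measurable_fun_shift.
exact: (integrable_shift h f2).
Qed.

Lemma dotC f g : dot f g = dot g f.
Proof. by apply: eq_Rintegral => x _; rewrite mulrC. Qed.

Lemma dotDl f g k : sqintegrable f -> sqintegrable g -> sqintegrable k ->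
  dot (fun x => f x + g x) k = dot f k + dot g k.
Proof.
move=> f2 g2 k2; rewrite /dot -RintegralD//; try exact: sqintegrable_mul.
by apply: eq_Rintegral => x _; rewrite mulrDl.
Qed.

Lemma dotZl f k (c : R) : sqintegrable f -> sqintegrable k ->
  dot (fun x => c * f x) k = c * dot f k.
Proof.
move=> f2 k2; rewrite /dot -RintegralZl//; try exact: sqintegrable_mul.
by apply: eq_Rintegral => x _; rewrite mulrA.
Qed.


Lemma dotNl f k : sqintegrable f -> sqintegrable k ->
  dot (fun x => - f x) k = - dot f k.
Proof.
move=> f2 k2; rewrite -mulN1r -dotZl//.
by apply: eq_Rintegral => x _; rewrite mulN1r.
Qed.

Lemma dotBl f g k : sqintegrable f -> sqintegrable g -> sqintegrable k ->
  dot (fun x => f x - g x) k = dot f k - dot g k.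
Proof.
by move=> f2 g2 k2; rewrite -dotNl// -dotDl//; exact: sqintegrableN.
Qed.

Lemma dot_ge0 f : 0 <= dot f f.
Proof. by apply: Rintegral_ge0 => x _; rewrite -expr2 sqr_ge0. Qed.

Lemma dot_shift h f g : sqintegrable f -> sqintegrable g ->
  dot (fun x => f (x + h)) (fun x => g (x + h)) = dot f g.
Proof.
by move=> f2 g2; apply: (Rintegral_shift h (f := fun x => f x * g x)); exact: sqintegrable_mul.
Qed.

Lemma eq_ae_dot f f' g g' :
  measurable_fun setT f -> measurable_fun setT f' ->
  measurable_fun setT g -> measurable_fun setT g' ->
  (\forall x \ae leb, f x = f' x) -> (\forall x \ae leb, g x = g' x) ->
  dot f g = dot f' g'.
Proof.
move=> mf mf' mg mg' ff' gg'; rewrite /dot /Rintegral; congr fine.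
apply: ae_eq_integral => //; try by apply/measurable_EFinP; exact: measurable_funM.
by apply: ae_imply2 ff' gg' => x /= -> ->.
Qed.

Lemma dot_integral f : sqintegrable f ->
  (\int[leb]_x (f x ^+ 2)%:E = (dot f f)%:E)%E.
Proof.
move=> [mf f2]; rewrite /dot /Rintegral fineK//.
exact: integrable_fin_num.
Qed.

Lemma sqr_dot_le f g : sqintegrable f -> sqintegrable g ->
  dot f g ^+ 2 <= dot f f * dot g g.
Proof.
move=> f2 g2; apply: sqr_le_of_quadratic_ge0 => [|t]; first exact: dot_ge0.
have tg2 := sqintegrableZ t g2.
have ftg2 := sqintegrableD f2 tg2.
have := dot_ge0 (fun x => f x + t * g x).
rewrite dotDl// dotZl// ![dot _ (fun x => f x + t * g x)]dotC !dotDl// !dotZl//.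
by rewrite [dot g f]dotC; lra.
Qed.

End square_integrable.

(** * Test functions *)
Section elementary.
Context {R : realType}.
Implicit Types (f : R -> R) (x l C : R).

(** First-order expansions are the form in which derivatives arise below, both for the piecewise
    quadratic steps and for the energy of a flow. *)
Lemma is_derive_remainder f x l :
  (forall e, 0 < e -> exists2 d, 0 < d & forall h, `|h| < d ->
    `|f (h + x) - f x - h * l| <= e * `|h|) -> is_derive x 1 f l.
Proof.
move=> H.
have cvgl : h^-1 *: (f (h *: 1 + x) - f x) @[h --> 0^'] --> l.
  apply/cvgrPdist_le => e e0; have [d d0 Hd] := H e e0.
  near=> h.
  have h0 : h != 0 by near: h; exact: nbhs_dnbhs_neq.
  have -> : h *: (1 : R) = h by rewrite /GRing.scale/= mulr1.
  rewrite /GRing.scale/= distrC.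
  have -> : h^-1 * (f (h + x) - f x) - l = h^-1 * (f (h + x) - f x - h * l).
    by rewrite [RHS]mulrBr mulKf.
  rewrite normrM normfV ler_pdivrMl ?normr_gt0// [leRHS]mulrC.
  by apply: Hd; near: h; exact: dnbhs0_lt.
split; first by apply/cvg_ex; exists l.
by apply/cvg_lim.
Unshelve. all: by end_near. Qed.

Lemma is_derive_quadratic_remainder f x l C :
  (forall h, `|f (h + x) - f x - h * l| <= C * h ^+ 2) -> is_derive x 1 f l.
Proof.
move=> H; have C0 : 0 <= C by have := H 1; rewrite expr1n mulr1; apply: le_trans.
apply: is_derive_remainder => e e0; exists (e / (C + 1)).
  by rewrite divr_gt0 ?ltr_wpDl.
move=> h; rewrite ltr_pdivlMr ?ltr_wpDl// => hd.
rewrite (le_trans (H h))// -real_normK ?num_real// expr2 mulrA ler_wpM2r//.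
by rewrite (le_trans _ (ltW hd))// mulrC ler_wpM2l// lerDl.
Qed.

Lemma lipschitz_continuous f C :
  (forall x y, `|f x - f y| <= C * `|x - y|) -> continuous f.
Proof.
move=> H x; apply/cvgrPdist_le => e e0.
have C0 : 0 <= C.
  by have := H 1 0; rewrite subr0 normr1 mulr1; apply: le_trans.
have C1 : 0 < C + 1 by rewrite ltr_wpDl.
near=> y; rewrite (le_trans (H _ _))//.
rewrite (@le_trans _ _ ((C + 1) * `|x - y|))//.
  by rewrite ler_wpM2r// lerDl.
rewrite -ler_pdivlMl//; near: y; apply: cvgr_dist_le => //.
by rewrite mulr_gt0 ?invr_gt0.
Unshelve. all: by end_near. Qed.

End elementary.

(** * C^1 approximations of a jump *)

Section smooth_step.
Context {R : realType}.
Implicit Types (x y h d a b : R).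

Let ramp x : R := Num.max 0 x.

Let ramp_lip x y : `|ramp x - ramp y| <= `|x - y|.
Proof.
rewrite /ramp !maxEle; case: ifPn => hx; case: ifPn => hy;
  rewrite ?subrr ?normr0// ler_norml; apply/andP; split;
  have := ler_norm (x - y); have := lerNnormlW (lexx `|x - y|); lra.
Qed.

(** [ramp] is the derivative of half its square, and it is 1-Lipschitz, whence the Taylor
    remainder. *)
Let ramp_rem x h : `|ramp (h + x) ^+ 2 / 2 - ramp x ^+ 2 / 2 - h * ramp x| <= h ^+ 2 / 2.
Proof.
rewrite /ramp !maxEle; case: ifPn => hx; case: ifPn => hy;
  rewrite ler_norml; apply/andP; split; nra.
Qed.

(* The rise takes place on ]0, 2 d[, so that smooth_step d converges to the
   indicator function of ]0, +oo[ at every point as d tends to 0. *)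
Definition smooth_step d x : R :=
  (ramp x ^+ 2 / 2 - 2 * (ramp (x - d) ^+ 2 / 2) + ramp (x - 2 * d) ^+ 2 / 2) / d ^+ 2.

(** The hat function on [[0, 2 * d]] with peak [d^-1] at [d] and mass one: a one-sided approximation
    of the Dirac mass at 0. *)
Definition tent d x : R := (ramp x - 2 * ramp (x - d) + ramp (x - 2 * d)) / d ^+ 2.

Lemma is_derive_smooth_step d x : is_derive x 1 (smooth_step d) (tent d x).
Proof.
(* The three ramps carry the weights 1, 2, 1, and each has a remainder of at most [h ^+ 2 / 2]. *)
apply: (is_derive_quadratic_remainder (C := 2 / d ^+ 2)) => h.
rewrite /smooth_step /tent [X in _ - X]mulrA -!mulrBl normrM [`|(d ^+ 2)^-1|]ger0_norm; last first.
  by rewrite invr_ge0 sqr_ge0.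
rewrite [leRHS]mulrAC ler_wpM2r ?invr_ge0 ?sqr_ge0//.
have := ramp_rem x h; have := ramp_rem (x - d) h; have := ramp_rem (x - 2 * d) h.
rewrite !addrA !ler_norml => /andP[? ?] /andP[? ?] /andP[? ?].
by apply/andP; split; lra.
Qed.

Lemma continuous_tent d : continuous (tent d).
Proof.
apply: (lipschitz_continuous (C := 4 / d ^+ 2)) => x y.
rewrite /tent -!mulrBl normrM [`|(d ^+ 2)^-1|]ger0_norm; last first.
  by rewrite invr_ge0 sqr_ge0.
rewrite [leRHS]mulrAC ler_wpM2r ?invr_ge0 ?sqr_ge0//.
have := ramp_lip x y; have := ramp_lip (x - d) (y - d).
have := ramp_lip (x - 2 * d) (y - 2 * d).
have E c : x - c - (y - c) = x - y by ring.
rewrite !E.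
move: (`|x - y|) => z; rewrite !ler_norml => /andP[? ?] /andP[? ?] /andP[? ?].
by apply/andP; split; lra.
Qed.

Lemma smooth_step_le0 d x : 0 < d -> x <= 0 -> smooth_step d x = 0.
Proof.
by move=> d0 x0; rewrite /smooth_step /ramp !max_l; lra.
Qed.

Lemma smooth_step_ge d x : 0 < d -> 2 * d <= x -> smooth_step d x = 1.
Proof.
move=> d0 xd; rewrite /smooth_step /ramp !max_r; try lra.
by field; rewrite gt_eqF.
Qed.

Lemma smooth_step_itv d x : 0 < d -> 0 <= smooth_step d x <= 1.
Proof.
move=> d0; have d20 : 0 < d ^+ 2 by rewrite exprn_gt0.
rewrite /smooth_step ler_pdivlMr// ler_pdivrMr// mul0r mul1r /ramp !maxEle.
by case: ifPn => h1; case: ifPn => h2; case: ifPn => h3; apply/andP; split; nra.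
Qed.

Lemma tent_le0 d x : 0 < d -> x <= 0 -> tent d x = 0.
Proof.
by move=> d0 x0; rewrite /tent /ramp !max_l; lra.
Qed.

Lemma tent_ge d x : 0 < d -> 2 * d <= x -> tent d x = 0.
Proof.
move=> d0 xd; by rewrite /tent /ramp !max_r; lra.
Qed.

Lemma tent_eq0 d x : 0 < d -> 2 * d < `|x| -> tent d x = 0.
Proof.
move=> d0; rewrite real_ltr_normr ?num_real// => /orP[h|h].
  by rewrite tent_ge// ltW.
by rewrite tent_le0//; lra.
Qed.

Lemma tent_itv d x : 0 < d -> 0 <= tent d x <= d^-1.
Proof.
move=> d0; have d20 : 0 < d ^+ 2 by rewrite exprn_gt0.
rewrite /tent ler_pdivlMr// ler_pdivrMr// mul0r.
have -> : d^-1 * d ^+ 2 = d by rewrite expr2 mulKf// gt_eqF.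
rewrite /ramp !maxEle.
by case: ifPn => h1; case: ifPn => h2; case: ifPn => h3; apply/andP; split; lra.
Qed.

End smooth_step.

Section test_functions.
Context {R : realType}.
Local Notation leb := (@lebesgue_measure R).
Implicit Types (f g chi : R -> R) (A a b d x : R).

Lemma integrable_compact_support chi A : continuous chi ->
  (forall x, A < `|x| -> chi x = 0) -> leb.-integrable setT (EFin \o chi).
Proof.
move=> cchi chi0.
have : leb.-integrable `[- A, A] (EFin \o chi).
  apply: (@continuous_compact_integrable R chi); first exact: segment_compact.
  exact: continuous_subspaceT.
rewrite integrable_mkcond//; apply: eq_integrable => // x _.
rewrite patchE; case: ifPn => // /negP; rewrite inE/= in_itv/= -ler_norml => /negP.
by rewrite -ltNge => /chi0 /= ->.
Qed.

Lemma sqintegrable_compact_support chi A : continuous chi ->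
  (forall x, A < `|x| -> chi x = 0) -> sqintegrable chi.
Proof.
move=> cchi chi0; split; first exact: continuous_measurable_fun.
apply: (@integrable_compact_support _ A).
  by move=> x; apply: cvgM; exact: cchi.
by move=> x /chi0 ->; rewrite expr0n.
Qed.

Lemma C1c_sqintegrable chi : C1c chi -> sqintegrable chi.
Proof.
move=> [dchi _ [A chi0]]; apply: (sqintegrable_compact_support (A := A)) => // x.
exact/differentiable_continuous/derivable1_diffP.
Qed.

Lemma C1c_derive_sqintegrable chi : C1c chi -> sqintegrable (derive1 chi).
Proof.
move=> [_ cchi [A chi0]]; apply: (sqintegrable_compact_support (A := A)) => // x Ax.
(* The set of points with [A] below their absolute value is open, so [chi] vanishes in a
   neighbourhood of [x]. *)
rewrite derive1E (near_eq_derive (g := cst 0)) ?derive_cst//.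
near=> y; apply: chi0; near: y.
have : `|y| @[y --> x] --> `|x| by apply: cvg_norm; exact: cvg_id.
by move/cvgr_gt; apply.
Unshelve. all: by end_near. Qed.

Lemma is_derive_addr f c x l : is_derive (x + c) 1 f l ->
  is_derive x 1 (fun y => f (y + c)) l.
Proof.
move=> H; have := @is_derive1_comp R f (fun y => y + c) x l 1 H.
by rewrite mulr1; apply; exact: is_derive_shift.
Qed.

Lemma C1c_shift chi c : C1c chi -> C1c (fun x => chi (x + c)).
Proof.
move=> [dchi cchi [A chi0]].
have dE x : is_derive x 1 (fun x => chi (x + c)) (derive1 chi (x + c)).
  by apply: is_derive_addr; rewrite derive1E; exact: derivableP.
split.
- by move=> x; have [] := dE x.
- have -> : derive1 (fun x => chi (x + c)) = fun x => derive1 chi (x + c).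
    by apply/funext => x; rewrite derive1E; have [_ ->] := dE x.
  move=> x; apply: continuous_comp; last exact: cchi.
  by apply: cvgD; [exact: cvg_id|exact: cvg_cst].
- exists (A + `|c|) => x Ax; apply: chi0.
  by rewrite -ltrBrDr in Ax; rewrite (lt_le_trans Ax)// lerB_normD.
Qed.

(** The tent is the derivative of a step that rises from 0 to 1 on [[0, 2 * d]]. *)
Lemma Rintegral_tent d a : 0 < d -> \int[leb]_x tent d (x - a) = 1.
Proof.
move=> d0.
have intt : leb.-integrable setT (EFin \o tent d).
  apply: (integrable_compact_support (A := 2 * d)); first exact: continuous_tent.
  by move=> x; exact: tent_eq0.
rewrite (Rintegral_shift (- a) intt).
rewrite /Rintegral.
have -> : (\int[leb]_x (tent d x)%:E = \int[leb]_(x in `[0%R, (2 * d)%R]) (tent d x)%:E)%E.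
  rewrite [RHS]integral_mkcond; apply: eq_integral => x _.
  rewrite patchE; case: ifPn => // /negP; rewrite inE/= in_itv/= => /negP.
  by rewrite negb_and -!ltNge => /orP[?|?]; [rewrite tent_le0// ltW | rewrite tent_ge// ltW].
have d2 : 0 < 2 * d by rewrite mulr_gt0.
have c0 : continuous (smooth_step d).
  move=> x; apply/differentiable_continuous/derivable1_diffP.
  by have [] := is_derive_smooth_step d x.
rewrite (continuous_FTC2 d2 (F := smooth_step d)).
- by rewrite smooth_step_ge// smooth_step_le0//= subr0.
- by apply: continuous_subspaceT; exact: continuous_tent.
- split; last 2 first.
  + by apply: cvg_at_right_filter; exact: c0.
  + by apply: cvg_at_left_filter; exact: c0.
  by move=> x _; have [] := is_derive_smooth_step d x.
- by move=> x _; rewrite derive1E; have [_ ->] := is_derive_smooth_step d x.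
Qed.

(** For [a <= b], an admissible test function that tends to the indicator of []a, b]] as [d] tends
    to 0, while its derivative tends to the Dirac mass at [a] minus the one at [b]. *)
Definition step_window a b d x := smooth_step d (x - a) - smooth_step d (x - b).

Lemma derive_step_window a b d x :
  is_derive x 1 (step_window a b d) (tent d (x - a) - tent d (x - b)).
Proof.
by apply: is_deriveB; apply: is_derive_addr; exact: is_derive_smooth_step.
Qed.

Lemma C1c_step_window a b d : 0 < d -> C1c (step_window a b d).
Proof.
move=> d0; split.
- by move=> x; have [] := derive_step_window a b d x.
- have -> : derive1 (step_window a b d) = fun x => tent d (x - a) - tent d (x - b).
    by apply/funext => x; rewrite derive1E; have [_ ->] := derive_step_window a b d x.
  have ct c : continuous (fun x => tent d (x - c)).
    move=> x; apply: (continuous_comp (f := fun y => y - c) (g := tent d)).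
      by apply: cvgB; [exact: cvg_id|exact: cvg_cst].
    exact: continuous_tent.
  by move=> x; apply: cvgB; exact: ct.
(* Beyond this bound both steps are 1 on the right, and both are 0 on the left. *)
- exists (`|a| + `|b| + 2 * d) => x; rewrite /step_window.
  have := ler_norm a; have := ler_norm b.
  have := ler_norm (- a); have := ler_norm (- b); rewrite !normrN => ? ? ? ?.
  rewrite real_ltr_normr ?num_real// => /orP[h|h].
    by rewrite !smooth_step_ge ?subrr//; have := normr_ge0 a; have := normr_ge0 b; lra.
  by rewrite !smooth_step_le0 ?subrr//; have := normr_ge0 a; have := normr_ge0 b; lra.
Qed.

End test_functions.

(** * Weak derivatives of real functions *)
Section real_weak_derivative.
Context {R : realType}.
Local Notation leb := (@lebesgue_measure R).
Implicit Types (f g chi : R -> R) (A a b d x : R).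

(** On a set of finite measure [1 + f ^+ 2] is an integrable majorant. *)
Lemma sqintegrable_integrable f (D : set (measurableTypeR R)) : measurable D -> (leb D < +oo)%E ->
  sqintegrable f -> leb.-integrable D (EFin \o f).
Proof.
move=> mD fD [mf f2].
apply: (@le_integrable _ _ _ leb D mD _ (EFin \o (fun x => 1 + f x ^+ 2))).
- by apply/measurable_EFinP; exact: measurable_funTS.
- move=> x _ /=; rewrite lee_fin [leRHS]ger0_norm ?addr_ge0 ?sqr_ge0//.
  by rewrite ler_norml; apply/andP; split; nra.
- apply: (integrableD mD (f := EFin \o cst 1) (g := EFin \o (fun x => f x ^+ 2))).
    apply: (measurable_bounded_integrable mD fD); first exact: measurable_cst.
    by exists 1; split; [exact: num_real|] => M M1 x _ /=; rewrite normr1 ltW.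
  exact: integrableS f2.
Qed.

Lemma sqintegrable_locally f : sqintegrable f -> locally_integrable setT f.
Proof.
move=> f2; split; [by case: f2|exact: openT|] => K _ cK.
have [_] := integrableP _ _ _
  (sqintegrable_integrable (compact_measurable cK) (compact_finite_measure cK) f2).
exact.
Qed.

(** The tent has mass one, is at most [(d_ n)^-1], and vanishes off the ball of radius [2 * d_ n]
    around [a], whose measure is [4 * d_ n]. The error is thus at most 4 times the mean deviation of
    [f] from [f a] on that ball, which tends to 0 at a Lebesgue point. *)
Lemma Rintegral_mul_tent_cvg f a (d_ : R^nat) : sqintegrable f -> lebesgue_pt f a ->
  (forall n, 0 < d_ n) -> d_ n @[n --> \oo] --> 0 ->
  \int[leb]_x (f x * tent (d_ n) (x - a)) @[n --> \oo] --> f a.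
Proof.
move=> f2 fa d0 dcvg.
have mf : measurable_fun setT f by case: f2.
have tent0 n x : d_ n > 0 -> ~ ball a (2 * d_ n) x -> tent (d_ n) (x - a) = 0.
  move=> dn; rewrite /ball/= => /negP; rewrite -leNgt ler_normr => /orP[h|h].
    by rewrite tent_le0//; lra.
  by rewrite tent_ge//; lra.
have tent2 n : sqintegrable (fun x => tent (d_ n) (x - a)).
  apply: sqintegrable_shift.
  apply: (sqintegrable_compact_support (A := 2 * d_ n)); first exact: continuous_tent.
  by move=> x; exact: tent_eq0.
have tent1 n : leb.-integrable setT (EFin \o (fun x => tent (d_ n) (x - a))).
  apply: (@integrable_shift _ (- a) (EFin \o tent (d_ n))).
  apply: (integrable_compact_support (A := 2 * d_ n)); first exact: continuous_tent.
  by move=> x; exact: tent_eq0.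
have bound n : (`|\int[leb]_x (f x * tent (d_ n) (x - a)) - f a|%:E <=
    4%:E * davg f a (2 * d_ n))%E.
  have dn := d0 n.
  have I1 := sqintegrable_mul f2 (tent2 n).
  have I2 : leb.-integrable setT (EFin \o (fun x => f a * tent (d_ n) (x - a))).
    exact: (integrableZl measurableT (f a) (tent1 n)).
  have -> : \int[leb]_x (f x * tent (d_ n) (x - a)) - f a =
      \int[leb]_x (f x * tent (d_ n) (x - a) - f a * tent (d_ n) (x - a)).
    by rewrite RintegralB// RintegralZl// Rintegral_tent// mulr1.
  have I3 : leb.-integrable setT (EFin \o (fun x => f x * tent (d_ n) (x - a) - f a * tent (d_ n) (x - a))).
    exact: (integrableB measurableT I1 I2).
  rewrite EFin_normr_Rintegral//.
  apply: (le_trans (le_abse_integral _ _ _)) => //.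
    by case/integrableP : I3.
  apply: (@le_trans _ _ (\int[leb]_(x in ball a (2 * d_ n)) ((d_ n)^-1 * `|f x - f a|)%:E)%E).
    rewrite [leRHS]integral_mkcond; apply: ge0_le_integral => //.
    + by apply/measurable_EFinP/measurableT_comp => //; case/integrableP : I3 => /measurable_EFinP.
    + apply/(measurable_restrictT _ _).1; first exact: measurable_ball.
      apply/measurable_EFinP/measurable_funM => //; apply: measurableT_comp => //.
      by apply: measurable_funTS; exact: measurable_funB.
    + move=> x _; rewrite patchE; case: ifPn => [xb|/negP xb].
        rewrite lee_fin -mulrBl normrM mulrC ler_wpM2r//.
        by have /andP[h1 h2] := tent_itv (x - a) dn; rewrite ger0_norm.
      by rewrite inE in xb; rewrite (tent0 _ _ dn xb) !mulr0 subrr abse0.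
  under eq_integral do rewrite EFinM.
  rewrite ge0_integralZl//; last 3 first.
  - exact: measurable_ball.
  - apply/measurable_EFinP; apply: measurableT_comp => //.
    by apply: measurable_funTS; exact: measurable_funB.
  - by rewrite lee_fin invr_ge0 ltW.
  rewrite /davg /iavg lebesgue_measure_ball ?mulr_ge0//; last exact: ltW.
  rewrite inver gt_eqF; last by rewrite pmulrn_rgt0// mulr_gt0.
  rewrite muleA -EFinM lee_wpmul2r//; first exact: integral_ge0.
  rewrite lee_fin le_eqVlt; apply/orP; left; apply/eqP.
  by field; rewrite gt_eqF.
have davg0 : davg f a (2 * d_ n) @[n --> \oo] --> 0%E.
  have /cvge_at_rightP/(_ (fun n => 2 * d_ n)) := fa; apply; split; first by move=> n; rewrite mulr_gt0.
  by rewrite -[X in _ --> X](mulr0 2); apply: cvgM => //; exact: cvg_cst.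
apply/cvgrPdist_lt => e e0.
have e4 : (0 < (e / 4)%:E)%E by rewrite lte_fin divr_gt0.
have [N _ HN] := davg0 _ (open_ereal_lt' e4).
exists N => // n /HN/= dn.
rewrite distrC -lte_fin (le_lt_trans (bound n))//.
rewrite (@lt_le_trans _ _ (4%:E * (e / 4)%:E)%E)//; first by rewrite lte_pmul2l.
by rewrite -EFinM lee_fin mulrC divfK.
Qed.

(** Dominated convergence. The bound [d_ n <= 1] keeps all windows inside [[a, b + 2]], where the
    absolute value of [g] is an integrable majorant. Each step rises strictly to the right of its
    threshold, so the limit is correct at the endpoints of []a, b]] too. *)
Lemma Rintegral_mul_step_window_cvg g a b (d_ : R^nat) : sqintegrable g -> a <= b ->
  (forall n, 0 < d_ n <= 1) -> d_ n @[n --> \oo] --> 0 ->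
  \int[leb]_x (g x * step_window a b (d_ n) x) @[n --> \oo] -->
    \int[leb]_(x in `]a, b]) g x.
Proof.
move=> g2 ab d01 dcvg.
have mg : measurable_fun setT g by case: g2.
have d0 n : 0 < d_ n by case/andP : (d01 n).
have small (e : R) : 0 < e -> \forall n \near \oo, 2 * d_ n <= e.
  move=> e0; have e2 : 0 < e / 2 by rewrite divr_gt0.
  have /cvgrPdist_le/(_ _ e2) := dcvg.
  apply: filterS => n; rewrite sub0r normrN => /ler_normlW; lra.
have window0 n x : x <= a \/ b + 2 <= x -> step_window a b (d_ n) x = 0.
  have /andP[dn dn1] := d01 n.
  by rewrite /step_window => -[xa|xb]; [rewrite !smooth_step_le0|rewrite !smooth_step_ge];
    rewrite ?subrr//; lra.
have mw n : measurable_fun setT (step_window a b (d_ n)).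
  by have [] := C1c_sqintegrable (C1c_step_window a b (d0 n)).
have mi : leb.-integrable `]a, b] (EFin \o g).
  apply: sqintegrable_integrable => //.
  by rewrite /= lebesgue_measure_itv/=; case: ifPn => // _; rewrite -EFinB ltry.
have [] := @dominated_convergence _ _ _ leb setT measurableT
  (fun n x => (g x * step_window a b (d_ n) x)%:E)
  ((EFin \o g) \_ `]a, b]) ((EFin \o (fun x => `|g x|)) \_ `[a, (b + 2)]).
- by move=> n; apply/measurable_EFinP; exact: (measurable_funM mg (mw n)).
- by move: (mi); rewrite integrable_mkcond// => /integrableP[].
- apply: aeW => x _; rewrite patchE; case: ifPn => [|/negP]; rewrite inE/= in_itv/=.
    move=> /andP[ax xb]; apply: cvg_near_cst.
    have /small : 0 < x - a by rewrite subr_gt0.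
    apply: filterS => n dn.
    by rewrite /step_window smooth_step_ge// smooth_step_le0 ?subr_le0// subr0 mulr1.
  move=> /negP; rewrite negb_and -leNgt -ltNge => /orP[xa|bx].
    by apply: cvg_near_cst; near=> n; rewrite window0 ?mulr0//; left.
  apply: cvg_near_cst.
  have /small : 0 < x - b by rewrite subr_gt0.
  apply: filterS => n dn.
  by rewrite /step_window !smooth_step_ge ?subrr ?mulr0//; lra.
- rewrite -integrable_mkcond//.
  apply: (@integrable_norm _ _ _ leb _ g) => //.
  apply: sqintegrable_integrable => //.
  by rewrite /= lebesgue_measure_itv/=; case: ifPn => // _; rewrite -EFinB ltry.
- apply: aeW => x n _; rewrite patchE; case: ifPn => [|/negP]; rewrite inE/= in_itv/=.
    move=> _; rewrite lee_fin normrM ler_piMr//.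
    have /andP[? ?] := smooth_step_itv (x - a) (d0 n).
    have /andP[? ?] := smooth_step_itv (x - b) (d0 n).
    by rewrite /step_window ler_norml; apply/andP; split; lra.
  move=> /negP; rewrite negb_and -!ltNge => h; rewrite window0 ?mulr0 ?normr0//.
  by case/orP : h => /ltW; [left|right].
move=> _ _.
rewrite -integral_mkcond => H.
apply: (@fine_cvg _ _ _ _ _ (\int[leb]_(x in `]a, b]) g x)).
rewrite /Rintegral fineK//.
exact: integrable_fin_num.
Unshelve. all: by end_near. Qed.

Definition real_weak_derivative f g := forall chi, C1c chi ->
  \int[leb]_x (f x * derive1 chi x) = - \int[leb]_x (g x * chi x).

(** Fundamental theorem of calculus for weak derivatives: test with [step_window a b d] and let [d]
    tend to 0. Being a Lebesgue point is what gives the values [f a] and [f b] a meaning here. *)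
Lemma weak_derivative_increment f g a b : sqintegrable f -> sqintegrable g ->
  real_weak_derivative f g -> lebesgue_pt f a -> lebesgue_pt f b -> a <= b ->
  f b - f a = \int[leb]_(x in `]a, b]) g x.
Proof.
move=> f2 g2 fg fa fb ab.
pose d_ n : R := n.+1%:R^-1.
have d0 n : 0 < d_ n by rewrite invr_gt0.
have d1 n : 0 < d_ n <= 1 by rewrite d0/= invf_le1// ler1n.
have dcvg : d_ n @[n --> \oo] --> 0 by exact: cvg_harmonic.
have cl := Rintegral_mul_step_window_cvg g2 ab d1 dcvg.
have cr := cvgB (Rintegral_mul_tent_cvg f2 fb d0 dcvg) (Rintegral_mul_tent_cvg f2 fa d0 dcvg).
rewrite -(cvg_lim (@Rhausdorff R) cl); apply/esym/cvg_lim; first exact: Rhausdorff.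
apply: cvg_trans; last exact: cr.
apply: near_eq_cvg; near=> n.
have := fg _ (C1c_step_window a b (d0 n)) => /eqP; rewrite eq_sym eqr_oppLR => /eqP ->.
have -> : derive1 (step_window a b (d_ n)) =
    fun x => tent (d_ n) (x - a) - tent (d_ n) (x - b).
  by apply/funext => x; rewrite derive1E; have [_ ->] := derive_step_window a b (d_ n) x.
have t2 c : sqintegrable (fun x => tent (d_ n) (x - c)).
  apply: sqintegrable_shift.
  apply: (sqintegrable_compact_support (A := 2 * d_ n)); first exact: continuous_tent.
  by move=> x; exact: tent_eq0.
under eq_Rintegral do rewrite mulrBr.
by rewrite RintegralB// ?opprB//; exact: sqintegrable_mul.
Unshelve. all: by end_near. Qed.

End real_weak_derivative.

(** * Integrals over short intervals *)

Section real_sobolev.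
Context {R : realType}.
Local Notation leb := (@lebesgue_measure R).
Implicit Types (f g chi : R -> R) (A a b d x h : R).

Lemma lebesgue_itvoc a b : a <= b -> leb `]a, b] = (b - a)%:E.
Proof.
move=> ab; rewrite lebesgue_measure_itv/= lte_fin EFinB; case: ltP => // ba.
by rewrite (@le_anti _ _ a b) ?ab// subee.
Qed.

(** Cauchy-Schwarz for the indicator of the interval and the restriction of [g] to it. *)
Lemma sqr_Rintegral_itv_le g a b : sqintegrable g -> a <= b ->
  (\int[leb]_(x in `]a, b]) g x) ^+ 2 <= (b - a) * \int[leb]_(x in `]a, b]) (g x ^+ 2).
Proof.
move=> g2 ab.
have mg : measurable_fun setT g by case: g2.
pose I := `]a, b]%classic : set R.
have mI : measurable I by exact: measurable_itv.
pose o := (\1_I : R -> R).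
have mo : measurable_fun setT o by exact: measurable_indic.
have o01 x : o x ^+ 2 = o x by rewrite /o indicE; case: (x \in I); rewrite ?expr1n ?expr0n.
have io : leb.-integrable setT (EFin \o o).
  exact: (integrable_indic_itv a b false false).
have o2 : sqintegrable o.
  by split => //; under eq_fun do rewrite o01.
have og2 : sqintegrable (fun x => o x * g x).
  apply: (le_sqintegrable (g := g) (C := 1)) => //; first exact: measurable_funM.
  by move=> x; rewrite mul1r normrM /o indicE; case: (x \in I); rewrite ?normr1 ?mul1r// normr0 mul0r.
have := sqr_dot_le o2 og2.
have -> : dot o (fun x => o x * g x) = \int[leb]_(x in `]a, b]) g x.
  rewrite [RHS]Rintegral_mkcond; apply: eq_Rintegral => x _; rewrite patchE /o indicE.
  by rewrite -/I; case: (x \in I); rewrite ?mul1r ?mul0r.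
have -> : dot o o = b - a.
  rewrite /dot; under eq_Rintegral do rewrite -expr2 o01.
  rewrite /Rintegral /o integral_indic// setIT.
  by rewrite [X in fine X](lebesgue_itvoc ab).
have -> : dot (fun x => o x * g x) (fun x => o x * g x) = \int[leb]_(x in `]a, b]) (g x ^+ 2).
  rewrite [RHS]Rintegral_mkcond; apply: eq_Rintegral => x _; rewrite patchE /o indicE.
  by rewrite -/I; case: (x \in I); rewrite ?mul1r ?mul0r// mulr0.
by [].
Qed.

(** Tonelli: a given [y] lies in []x, x + h]] exactly for [x] in [[y - h, y[], a set of measure
    [h]. *)
Lemma integral_sliding_window h (k : R -> \bar R) : 0 <= h -> measurable_fun setT k ->
  (forall x, 0 <= k x)%E ->
  measurable_fun setT (fun x : R => \int[leb]_(y in `]x, (x + h)%R]) k y)%E /\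
  (\int[leb]_x \int[leb]_(y in `]x, (x + h)%R]) k y = h%:E * \int[leb]_y k y)%E.
Proof.
move=> h0 mk k0.
pose F (z : measurableTypeR R * measurableTypeR R) : \bar R :=
  ((\1_`]0, h]%classic (z.2 - z.1) : R)%:E * k z.2)%E.
have F0 z : (0 <= F z)%E by rewrite mule_ge0.
have mF : measurable_fun setT F.
  apply: emeasurable_funM.
    apply/measurable_EFinP.
    apply: (@measurableT_comp _ _ _ _ _ _ (\1_`]0, h]%classic : R -> R)) => //.
    by apply: measurable_funB; [exact: measurable_snd|exact: measurable_fst].
  exact: measurableT_comp mk measurable_snd.
have FE x : (\int[leb]_y F (x, y) = \int[leb]_(y in `]x, (x + h)%R]) k y)%E.
  rewrite [RHS]integral_mkcond; apply: eq_integral => y _.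
  rewrite patchE /F/= indicE.
  have -> : (y - x \in `]0, h]%classic) = (y \in `]x, (x + h)%R]%classic).
    by apply/idP/idP; rewrite !inE/= !in_itv/= subr_gt0 lerBlDl.
  by case: ifPn => _; rewrite ?mul1e ?mul0e.
split.
  have := @measurable_fun_fubini_tonelli_F _ _ _ _ R leb F mF F0.
  by rewrite (_ : fubini_F _ F = fun x => \int[leb]_(y in `]x, (x + h)%R]) k y)%E//; apply/funext.
have := @fubini_tonelli _ _ _ _ R leb leb F mF F0.
under eq_integral do rewrite FE; move=> ->.
have -> : (\int[leb]_y \int[leb]_x F (x, y) = \int[leb]_y (h%:E * k y))%E.
  apply: eq_integral => y _; rewrite /F/=.
  rewrite ge0_integralZr//; last first.
    apply/measurable_EFinP.
    apply: (@measurableT_comp _ _ _ _ _ _ (\1_`]0, h]%classic : R -> R)) => //.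
    by apply: measurable_funB; [exact: measurable_cst|exact: measurable_id].
  congr (_ * _)%E.
  have -> : (\int[leb]_x (\1_`]0, h]%classic (y - x) : R)%:E =
     \int[leb]_x (\1_`[(y - h)%R, y[%classic x : R)%:E)%E.
    apply: eq_integral => x _; rewrite !indicE.
    congr ((_ : bool)%:R%:E).
    by apply/idP/idP; rewrite !inE/= !in_itv/= subr_gt0 lerBlDl lerBlDr => /andP[-> ->].
  rewrite integral_indic// setIT.
  transitivity (leb `[(y - h), y[%classic) => //.
  rewrite lebesgue_measure_itv/= lte_fin ltrBlDr; case: ifPn => [_|].
    by rewrite -EFinB opprB addrC subrK.
  by rewrite ltrDl -leNgt => h00; rewrite (@le_anti _ _ h 0) ?h00.
by rewrite ge0_integralZl.
Qed.

End real_sobolev.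

(** * Translations, difference quotients and the Sobolev bound for real functions *)

Section real_sobolev_estimates.
Context {R : realType}.
Local Notation leb := (@lebesgue_measure R).
Implicit Types (f g chi : R -> R) (A a b d x h : R).

Let ae_lebesgue_pt f : sqintegrable f -> \forall x \ae leb, lebesgue_pt f x.
Proof. by move=> /sqintegrable_locally; exact: lebesgue_differentiation. Qed.

Let Rintegral_itv_EFin g a b : sqintegrable g ->
  ((\int[leb]_(x in `]a, b]) (g x ^+ 2))%:E = \int[leb]_(x in `]a, b]) (g x ^+ 2)%:E)%E.
Proof.
move=> [_ g2]; rewrite /Rintegral fineK//; apply: integrable_fin_num => //.
exact: integrableS g2.
Qed.

(** For almost every [x] both [x] and [x + h] are Lebesgue points, so the increment is an integral
    of [g] over []x, x + h]]. Cauchy-Schwarz gives one factor [h], and integrating the sliding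
    window in [x] gives the other. *)
Lemma dot_translate_sub_le f g h : sqintegrable f -> sqintegrable g ->
  real_weak_derivative f g -> 0 <= h ->
  dot (fun x => f (x + h) - f x) (fun x => f (x + h) - f x) <= h ^+ 2 * dot g g.
Proof.
move=> f2 g2 fg h0.
have d2 := sqintegrableB (sqintegrable_shift h f2) f2.
have mg : measurable_fun setT g by case: g2.
have mk : measurable_fun setT (fun x => (g x ^+ 2)%:E).
  by apply/measurable_EFinP; exact: measurable_funX.
have k0 x : (0 <= (g x ^+ 2)%:E)%E by rewrite lee_fin sqr_ge0.
have [mw intw] := integral_sliding_window h0 mk k0.
rewrite -lee_fin -dot_integral// EFinM -dot_integral// expr2 EFinM -muleA -intw.
rewrite -ge0_integralZl//; last by move=> x _; exact: integral_ge0.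
apply: ae_ge0_le_integral => //.
- by move=> x _; rewrite lee_fin sqr_ge0.
- by apply/measurable_EFinP; apply: measurable_funX; case: d2.
- by move=> x _; rewrite mule_ge0//; exact: integral_ge0.
- by apply: measurable_funeM.
- apply: ae_imply2 (ae_lebesgue_pt f2) (ae_shift h (ae_lebesgue_pt f2)) => x fx fxh _.
  rewrite (weak_derivative_increment f2 g2 fg fx fxh) ?lerDl//.
  rewrite -Rintegral_itv_EFin// -EFinM lee_fin.
  by apply: (le_trans (sqr_Rintegral_itv_le g2 _)); rewrite ?lerDl// addrAC subrr add0r.
Qed.

(** The quotient is the mean of [g] over []x, x + n.+1%:R^-1]], to which Lebesgue differentiation
    along nicely shrinking sets applies. *)
Lemma ae_difference_quotient_cvg f g : sqintegrable f -> sqintegrable g ->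
  real_weak_derivative f g ->
  \forall x \ae leb, n.+1%:R * (f (x + n.+1%:R^-1) - f x) @[n --> \oo] --> g x.
Proof.
move=> f2 g2 fg.
pose d_ n : R := n.+1%:R^-1.
have d0 n : 0 < d_ n by rewrite invr_gt0.
have dcvg : d_ n @[n --> \oo] --> 0 by exact: cvg_harmonic.
pose E x n := `]x, x + d_ n]%classic : set R.
have muE x n : leb (E x n) = (d_ n)%:E.
  by rewrite /E lebesgue_itvoc ?lerDl ?ltW// addrAC subrr add0r.
have niceE x : nicely_shrinking x (E x).
  have d20 n : 0 < 2 * d_ n by rewrite mulr_gt0.
  split; first by move=> n; exact: measurable_itv.
  (* The interval contains its right endpoint, so it is enclosed in the open ball of radius
     [2 * d_ n], whose measure is 4 times its length. *)
  exists (4, fun n => PosNum (d20 n)); split => //=.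
  - by rewrite -[X in _ --> X](mulr0 2); apply: cvgM => //; exact: cvg_cst.
  - move=> n y; rewrite /E/= in_itv/= /ball/= => /andP[xy yx].
    have dn := d0 n; rewrite ltr_norml; apply/andP; split; lra.
  - move=> n; rewrite muE lebesgue_measure_ball; last exact: ltW.
    by rewrite -EFinM lee_fin; lra.
(* Only countably many increments occur, so the union of their exceptional sets is still null. *)
have H : \forall x \ae leb, forall n, lebesgue_pt f (x + d_ n).
  by apply: ae_foralln => n; apply: ae_shift; exact: ae_lebesgue_pt.
have H' : \forall x \ae leb, lebesgue_pt f x /\ lebesgue_pt g x.
  by apply: ae_imply2 (ae_lebesgue_pt f2) (ae_lebesgue_pt g2).
apply: ae_imply2 H H' => x fxn [fx gx].
have gcvg := nice_lebesgue_differentiation niceE (sqintegrable_locally g2) gx.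
apply: cvg_trans; last exact: (fine_cvg gcvg).
apply: near_eq_cvg; near=> n.
rewrite /= (weak_derivative_increment f2 g2 fg fx (fxn n)) ?lerDl ?ltW//.
rewrite fineM.
- by rewrite muE inver gt_eqF//= /d_ invrK.
- by rewrite muE inver gt_eqF.
- apply: integrable_fin_num; first exact: measurable_itv.
  apply: (sqintegrable_integrable (f := g)) => //; first exact: measurable_itv.
  by rewrite muE ltry.
Unshelve. all: by end_near. Qed.

(** Both functions are limits of the same difference quotients. *)
Lemma ae_weak_derivative_unique f g1 g2 : sqintegrable f ->
  sqintegrable g1 -> sqintegrable g2 ->
  real_weak_derivative f g1 -> real_weak_derivative f g2 ->
  \forall x \ae leb, g1 x = g2 x.
Proof.
move=> f2 g12 g22 fg1 fg2.
apply: ae_imply2 (ae_difference_quotient_cvg f2 g12 fg1) (ae_difference_quotient_cvg f2 g22 fg2).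
by move=> x h1 h2; apply: cvg_unique h1 h2; exact: Rhausdorff.
Qed.

(** Converse of [dot_translate_sub_le]: the quotients [q n] have squared norm at most [B] and
    converge to [g] almost everywhere. *)
Lemma dot_weak_derivative_le f g (B : R) : sqintegrable f -> sqintegrable g ->
  real_weak_derivative f g ->
  (forall n, dot (fun x => f (x + n.+1%:R^-1) - f x) (fun x => f (x + n.+1%:R^-1) - f x)
     <= (n.+1%:R^-1) ^+ 2 * B) ->
  dot g g <= B.
Proof.
move=> f2 g2 fg HB.
have mg : measurable_fun setT g by case: g2.
pose q n x := n.+1%:R * (f (x + n.+1%:R^-1) - f x).
have q2 n : sqintegrable (q n).
  by apply: sqintegrableZ; apply: sqintegrableB => //; exact: sqintegrable_shift.
have mq n : measurable_fun setT (fun x => (q n x ^+ 2)%:E).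
  by apply/measurable_EFinP; apply: measurable_funX; case: (q2 n).
have qB n : (\int[leb]_x (q n x ^+ 2)%:E <= B%:E)%E.
  have D2 := sqintegrableB (sqintegrable_shift n.+1%:R^-1 f2) f2.
  rewrite dot_integral// lee_fin (dotZl _ D2 (q2 n)) dotC (dotZl _ D2 D2).
  rewrite mulrA -expr2.
  have n0 : (0 : R) < n.+1%:R ^+ 2 by rewrite exprn_gt0.
  rewrite -ler_pdivlMl//; apply: (le_trans (HB n)).
  by rewrite exprVn.
rewrite -lee_fin -dot_integral//.
have -> : (\int[leb]_x (g x ^+ 2)%:E = \int[leb]_x limn_einf (fun n => (q n x ^+ 2)%:E))%E.
  apply: ae_eq_integral => //.
  - by apply/measurable_EFinP; exact: measurable_funX.
  (* Measurability of the lower limit is deduced from that of the upper limit by a change of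
     sign. *)
  - have -> : (fun x => limn_einf (fun n => (q n x ^+ 2)%:E)) =
        -%E \o (fun x => limn_esup (fun n => - (q n x ^+ 2)%:E))%E.
      apply/funext => x.
      by have := limn_esupN (fun n => (q n x ^+ 2)%:E) => /(congr1 -%E); rewrite oppeK.
    apply: measurableT_comp => //.
    apply: (measurable_fun_limn_esup (f := fun n x => - (q n x ^+ 2)%:E)%E) => n.
    exact: measurableT_comp.
  - apply: ae_imply (ae_difference_quotient_cvg f2 g2 fg) => x qx _.
    have qx2 : (q n x ^+ 2)%:E @[n --> \oo] --> (g x ^+ 2)%:E.
      by apply: cvg_EFin; [exact: nearW|apply: cvgM].
    by rewrite (cvg_limn_einf_sup qx2).
apply: (le_trans (fatou leb measurableT mq _)).
  by move=> n x _; rewrite lee_fin sqr_ge0.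
rewrite limn_einf_lim; apply: lime_le; first exact: is_cvg_einfs.
apply: nearW => n; apply: le_trans (qB n).
by apply: ereal_inf_lbound; exists n => /=.
Qed.

(** For Lebesgue points [b] and [x] with [x] in []b, b + 1]], [f b] differs from [f x] by an
    integral of [g] whose square is at most [dot g g], as the length is at most 1. Hence
    [f b ^+ 2 <= 2 * f x ^+ 2 + 2 * dot g g], and averaging over [x] in this interval of length 1
    gives the bound. *)
Lemma ae_sqr_le_sobolev f g : sqintegrable f -> sqintegrable g ->
  real_weak_derivative f g ->
  \forall x \ae leb, f x ^+ 2 <= 2 * (dot f f + dot g g).
Proof.
move=> f2 g2 fg.
have mf : measurable_fun setT f by case: (f2).
have mf2 : measurable_fun setT (fun x => 2 * f x ^+ 2).
  by apply: measurable_funM; [exact: measurable_cst | exact: measurable_funX].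
apply: ae_imply (ae_lebesgue_pt f2) => b fb.
have b1 : b <= b + 1 by rewrite lerDl.
have mu1 : leb `]b, (b + 1)] = 1%E by rewrite lebesgue_itvoc// addrAC subrr add0r.
have : (\int[leb]_(x in `]b, (b + 1)%R]) (f b ^+ 2)%:E <=
  \int[leb]_(x in `]b, (b + 1)%R]) (2 * f x ^+ 2 + 2 * dot g g)%:E)%E.
  apply: ae_ge0_le_integral => //.
  - by move=> x _; rewrite lee_fin sqr_ge0.
  - by move=> x _; rewrite lee_fin; apply: addr_ge0; rewrite mulr_ge0 ?sqr_ge0 ?dot_ge0.
  - by apply/measurable_EFinP; apply: measurable_funTS; apply: measurable_funD.
  - apply: ae_imply (ae_lebesgue_pt f2) => x fx; rewrite /= in_itv/= => /andP[bx xb].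
    rewrite lee_fin.
    have := weak_derivative_increment f2 g2 fg fb fx (ltW bx).
    have := sqr_Rintegral_itv_le g2 (ltW bx).
    have : \int[leb]_(y in `]b, x]) (g y ^+ 2) <= dot g g.
      rewrite -lee_fin Rintegral_itv_EFin// -dot_integral//.
      apply: ge0_subset_integral => //.
      + by apply/measurable_EFinP; apply: measurable_funX; case: g2.
      + by move=> y _; rewrite lee_fin sqr_ge0.
    have : 0 <= \int[leb]_(y in `]b, x]) (g y ^+ 2) by apply: Rintegral_ge0 => y _; rewrite sqr_ge0.
    move: (\int[leb]_(y in `]b, x]) (g y ^+ 2)) (\int[leb]_(y in `]b, x]) g y) (dot g g).
    move=> I J D I0 ID JI fJ.
    have JD : J ^+ 2 <= D by nra.
    have -> : f b = f x - J by rewrite -fJ opprB addrC subrK.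
    by have := sqr_ge0 (f x + J); nra.
rewrite integral_cst// [X in (_ * X)%E]mu1 mule1.
move=> /le_trans; rewrite -lee_fin; apply.
under eq_integral do rewrite EFinD.
rewrite ge0_integralD//; last 3 first.
- by move=> x _; rewrite lee_fin mulr_ge0 ?sqr_ge0.
- by apply/measurable_EFinP; exact: measurable_funTS.
- by move=> x _; rewrite lee_fin mulr_ge0 ?dot_ge0.
rewrite integral_cst// [X in (_ + _ * X)%E]mu1 mule1 mulrDr EFinD leeD2r//.
rewrite EFinM -dot_integral// -ge0_integralZl//; last 2 first.
- by apply/measurable_EFinP; exact: measurable_funX.
- by move=> x _; rewrite lee_fin sqr_ge0.
apply: ge0_subset_integral => //.
- exact/measurable_EFinP.
- by move=> x _; rewrite lee_fin mulr_ge0 ?sqr_ge0.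
Qed.

End real_sobolev_estimates.

(** * Complex-valued functions *)
Section complex_L2.
Context {R : realType}.
Local Notation leb := (@lebesgue_measure R).
Local Notation normc := (@Normc.normc R).
Local Notation Re := (@complex.Re R).
Local Notation Im := (@complex.Im R).
Implicit Types (f g k u v phi : R -> R[i]) (h c : R) (z w : R[i]).

Lemma complex_ReB z w : Re (z - w) = Re z - Re w.
Proof. by case: z w => [a b] [a' b']. Qed.
Lemma complex_ImB z w : Im (z - w) = Im z - Im w.
Proof. by case: z w => [a b] [a' b']. Qed.
Lemma complex_ReD z w : Re (z + w) = Re z + Re w.
Proof. by case: z w => [a b] [a' b']. Qed.
Lemma complex_ImD z w : Im (z + w) = Im z + Im w.
Proof. by case: z w => [a b] [a' b']. Qed.
Lemma complex_ReZ c z : Re (c%:C%C * z) = c * Re z.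
Proof. by case: z => [a b] /=; rewrite mul0r subr0. Qed.
Lemma complex_ImZ c z : Im (c%:C%C * z) = c * Im z.
Proof. by case: z => [a b] /=; rewrite mul0r addr0. Qed.
Lemma complex_Re_iM z : Re ('i%C * z) = - Im z.
Proof. by case: z => [a b] /=; rewrite mul0r mul1r sub0r. Qed.
Lemma complex_Im_iM z : Im ('i%C * z) = Re z.
Proof. by case: z => [a b] /=; rewrite mul0r mul1r add0r. Qed.

Lemma sqr_normc z : normc z ^+ 2 = Re z ^+ 2 + Im z ^+ 2.
Proof. by case: z => a b; rewrite /= sqr_sqrtr// addr_ge0 ?sqr_ge0. Qed.

Lemma normc_ge0 z : 0 <= normc z.
Proof. by case: z => a b; rewrite /= sqrtr_ge0. Qed.

Definition csqintegrable f := sqintegrable (fun x => Re (f x)) /\ sqintegrable (fun x => Im (f x)).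

(** The real part of the complex pairing: the inner product of L^2(R; C) as a real Hilbert space. *)
Definition cdot f g : R :=
  dot (fun x => Re (f x)) (fun x => Re (g x)) + dot (fun x => Im (f x)) (fun x => Im (g x)).

Definition cnorm f : R := Num.sqrt (cdot f f).

Lemma csqintegrableB f g : csqintegrable f -> csqintegrable g -> csqintegrable (f \- g).
Proof.
move=> [f1 f2] [g1 g2]; split.
  by under eq_fun do rewrite complex_ReB; exact: sqintegrableB.
by under eq_fun do rewrite complex_ImB; exact: sqintegrableB.
Qed.

Lemma csqintegrableD f g : csqintegrable f -> csqintegrable g -> csqintegrable (f \+ g).
Proof.
move=> [f1 f2] [g1 g2]; split.
  by under eq_fun do rewrite complex_ReD; exact: sqintegrableD.
by under eq_fun do rewrite complex_ImD; exact: sqintegrableD.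
Qed.

Lemma csqintegrableZ c f : csqintegrable f -> csqintegrable (fun x => c%:C%C * f x).
Proof.
move=> [f1 f2]; split.
  by under eq_fun do rewrite complex_ReZ; exact: sqintegrableZ.
by under eq_fun do rewrite complex_ImZ; exact: sqintegrableZ.
Qed.

Lemma csqintegrable_iM f : csqintegrable f -> csqintegrable (fun x => 'i%C * f x).
Proof.
move=> [f1 f2]; split.
  by under eq_fun do rewrite complex_Re_iM; exact: sqintegrableN.
by under eq_fun do rewrite complex_Im_iM.
Qed.

Lemma csqintegrable_shift h f : csqintegrable f -> csqintegrable (fun x => f (x + h)).
Proof.
by move=> [f1 f2]; split;
  [exact: (sqintegrable_shift h f1)|exact: (sqintegrable_shift h f2)].
Qed.

Lemma cdotC f g : cdot f g = cdot g f.
Proof. by rewrite /cdot dotC [X in _ + X]dotC. Qed.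

Lemma cdotBl f g k : csqintegrable f -> csqintegrable g -> csqintegrable k ->
  cdot (f \- g) k = cdot f k - cdot g k.
Proof.
move=> [f1 f2] [g1 g2] [k1 k2]; rewrite /cdot.
under eq_fun do rewrite complex_ReB; under [X in _ + dot X _]eq_fun do rewrite complex_ImB.
by rewrite !dotBl// opprD addrACA.
Qed.

Lemma cdotDl f g k : csqintegrable f -> csqintegrable g -> csqintegrable k ->
  cdot (f \+ g) k = cdot f k + cdot g k.
Proof.
move=> [f1 f2] [g1 g2] [k1 k2]; rewrite /cdot.
under eq_fun do rewrite complex_ReD; under [X in _ + dot X _]eq_fun do rewrite complex_ImD.
by rewrite !dotDl// addrACA.
Qed.

Lemma cdotZl c f k : csqintegrable f -> csqintegrable k ->
  cdot (fun x => c%:C%C * f x) k = c * cdot f k.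
Proof.
move=> [f1 f2] [k1 k2]; rewrite /cdot.
under eq_fun do rewrite complex_ReZ; under [X in _ + dot X _]eq_fun do rewrite complex_ImZ.
by rewrite !dotZl// mulrDr.
Qed.

Lemma cdotDr f g k : csqintegrable f -> csqintegrable g -> csqintegrable k ->
  cdot k (f \+ g) = cdot k f + cdot k g.
Proof. by move=> f2 g2 k2; rewrite cdotC cdotDl// cdotC [cdot g k]cdotC. Qed.

Lemma cdotZr c f k : csqintegrable f -> csqintegrable k ->
  cdot k (fun x => c%:C%C * f x) = c * cdot k f.
Proof. by move=> f2 k2; rewrite cdotC cdotZl// cdotC. Qed.

Lemma cdot_iMl f g : csqintegrable f -> csqintegrable g ->
  cdot (fun x => 'i%C * f x) g =
    dot (fun x => Re (f x)) (fun x => Im (g x)) - dot (fun x => Im (f x)) (fun x => Re (g x)).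
Proof.
move=> [f1 f2] [g1 g2]; rewrite /cdot.
under eq_fun do rewrite complex_Re_iM; under [X in _ + dot X _]eq_fun do rewrite complex_Im_iM.
by rewrite dotNl// addrC.
Qed.

(** Multiplication by i is skew; this is what removes the dispersive term from the energy
    balance. *)
Lemma cdot_iM_self f : csqintegrable f -> cdot (fun x => 'i%C * f x) f = 0.
Proof. by move=> f2; rewrite cdot_iMl// dotC subrr. Qed.

Lemma cdot_shift h f g : csqintegrable f -> csqintegrable g ->
  cdot (fun x => f (x + h)) (fun x => g (x + h)) = cdot f g.
Proof.
move=> [f1 f2] [g1 g2]; rewrite /cdot.
by rewrite (dot_shift h f1 g1) (dot_shift h f2 g2).
Qed.

Lemma cdot_ge0 f : 0 <= cdot f f.
Proof. by rewrite addr_ge0 ?dot_ge0. Qed.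

Lemma cnorm_ge0 f : 0 <= cnorm f.
Proof. exact: sqrtr_ge0. Qed.

Lemma sqr_cnorm f : cnorm f ^+ 2 = cdot f f.
Proof. by rewrite sqr_sqrtr// cdot_ge0. Qed.

Lemma normr_cdot_le f g : csqintegrable f -> csqintegrable g -> `|cdot f g| <= cnorm f * cnorm g.
Proof.
move=> f2 g2; rewrite -sqrtrM ?cdot_ge0// -sqrtr_sqr ler_sqrt ?mulr_ge0 ?cdot_ge0//.
apply: sqr_le_of_quadratic_ge0 => [|t]; first exact: cdot_ge0.
have tg2 := csqintegrableZ t g2; have ftg2 := csqintegrableD f2 tg2.
have := cdot_ge0 (f \+ (fun x => t%:C%C * g x)).
rewrite cdotDl// cdotZl// !cdotDr// !cdotZr// [cdot g f]cdotC; lra.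
Qed.

Lemma cnorm_shift h f : csqintegrable f -> cnorm (fun x => f (x + h)) = cnorm f.
Proof. by move=> f2; rewrite /cnorm cdot_shift. Qed.

Lemma cnorm_iM f : csqintegrable f -> cnorm (fun x => 'i%C * f x) = cnorm f.
Proof.
move=> [f1 f2]; rewrite /cnorm /cdot; congr Num.sqrt.
under eq_fun do rewrite complex_Re_iM; under [X in _ + dot X _]eq_fun do rewrite complex_Im_iM.
under [X in _ + dot _ X]eq_fun do rewrite complex_Im_iM.
rewrite addrC; congr (_ + _).
by apply: eq_Rintegral => x _; rewrite mulrNN.
Qed.

Lemma cnormD f g : csqintegrable f -> csqintegrable g -> cnorm (f \+ g) <= cnorm f + cnorm g.
Proof.
move=> f2 g2; rewrite -(@ler_pXn2r _ 2) ?nnegrE ?addr_ge0 ?cnorm_ge0//.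
have := normr_cdot_le f2 g2 => /ler_normlW.
rewrite sqr_cnorm cdotDl ?cdotDr//; last exact: csqintegrableD.
by rewrite sqrrD !sqr_cnorm [cdot g f]cdotC; lra.
Qed.

Lemma cnormN f : csqintegrable f -> cnorm (fun x => (-1)%:C%C * f x) = cnorm f.
Proof.
move=> f2; have nf2 := csqintegrableZ (-1) f2.
by rewrite /cnorm cdotZl// cdotZr// !mulN1r opprK.
Qed.

Lemma cnormB f g : csqintegrable f -> csqintegrable g -> cnorm (f \- g) <= cnorm f + cnorm g.
Proof.
move=> f2 g2; rewrite -[cnorm g]cnormN//.
have -> : f \- g = f \+ (fun x => (-1)%:C%C * g x).
  by apply/funext => x /=; rewrite raddfN/= mulN1r.
by apply: cnormD => //; exact: csqintegrableZ.
Qed.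

Lemma eq_ae_cnorm f g : csqintegrable f -> csqintegrable g ->
  (\forall x \ae leb, f x = g x) -> cnorm f = cnorm g.
Proof.
move=> [[f1 _] [f2 _]] [[g1 _] [g2 _]] fg; rewrite /cnorm /cdot.
congr (Num.sqrt (_ + _)); apply: eq_ae_dot => //; by apply: ae_imply fg => x ->.
Qed.

Lemma le_cnorm f g c : csqintegrable f -> csqintegrable g -> 0 <= c ->
  (\forall x \ae leb, normc (f x) <= c * normc (g x)) -> cnorm f <= c * cnorm g.
Proof.
move=> f2 g2 c0 fg.
rewrite -(@ler_pXn2r _ 2) ?nnegrE ?mulr_ge0 ?cnorm_ge0// exprMn !sqr_cnorm.
have E k : csqintegrable k -> ((cdot k k)%:E = \int[leb]_x (normc (k x) ^+ 2)%:E)%E.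
  move=> [k1 k2]; under eq_integral do rewrite sqr_normc EFinD.
  rewrite ge0_integralD//; last 4 first.
  - by move=> x _; rewrite lee_fin sqr_ge0.
  - by apply/measurable_EFinP; apply: measurable_funX; case: k1.
  - by move=> x _; rewrite lee_fin sqr_ge0.
  - by apply/measurable_EFinP; apply: measurable_funX; case: k2.
  by rewrite !dot_integral.
have mE k : csqintegrable k -> measurable_fun setT (fun x => (normc (k x) ^+ 2)%:E).
  move=> [[k1 _] [k2 _]]; apply/measurable_EFinP.
  under eq_fun do rewrite sqr_normc.
  by apply: measurable_funD; exact: measurable_funX.
rewrite -lee_fin EFinM !E// -ge0_integralZl//; last 3 first.
- exact: (mE g g2).
- by move=> x _; rewrite lee_fin sqr_ge0.
- by rewrite lee_fin sqr_ge0.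
apply: ae_ge0_le_integral => //.
- by move=> x _; rewrite lee_fin sqr_ge0.
- exact: (mE f f2).
- by move=> x _; rewrite mule_ge0// lee_fin sqr_ge0.
- by apply: measurable_funeM; exact: (mE g g2).
- apply: ae_imply fg => x fgx _; rewrite -EFinM lee_fin -exprMn.
  by rewrite lerXn2r// nnegrE ?mulr_ge0 ?normc_ge0.
Qed.

End complex_L2.

Section real_weak_derivative_operations.
Context {R : realType}.
Implicit Types (f g : R -> R) (h c : R).

Lemma real_weak_derivativeB f1 g1 f2 g2 : sqintegrable f1 -> sqintegrable g1 ->
  sqintegrable f2 -> sqintegrable g2 ->
  real_weak_derivative f1 g1 -> real_weak_derivative f2 g2 ->
  real_weak_derivative (fun x => f1 x - f2 x) (fun x => g1 x - g2 x).
Proof.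
move=> sf1 sg1 sf2 sg2 H1 H2 chi chiC.
have s1 := C1c_sqintegrable chiC; have s2 := C1c_derive_sqintegrable chiC.
have := dotBl sf1 sf2 s2; rewrite /dot => ->.
have := dotBl sg1 sg2 s1; rewrite /dot => ->.
by rewrite (H1 _ chiC) (H2 _ chiC) opprB opprK addrC.
Qed.

Lemma real_weak_derivativeZ c f g : sqintegrable f -> sqintegrable g ->
  real_weak_derivative f g -> real_weak_derivative (fun x => c * f x) (fun x => c * g x).
Proof.
move=> sf sg H chi chiC.
have s1 := C1c_sqintegrable chiC; have s2 := C1c_derive_sqintegrable chiC.
have := dotZl c sf s2; rewrite /dot => ->.
have := dotZl c sg s1; rewrite /dot => ->.
by rewrite (H _ chiC) mulrN.
Qed.

(** The shift is moved to the test function, which is translated by [- h]. *)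
Lemma real_weak_derivative_shift h f g : sqintegrable f -> sqintegrable g ->
  real_weak_derivative f g ->
  real_weak_derivative (fun x => f (x + h)) (fun x => g (x + h)).
Proof.
move=> sf sg H chi chiC.
have chiC' := C1c_shift (- h) chiC.
have s1 := C1c_sqintegrable chiC; have s2 := C1c_derive_sqintegrable chiC.
have s1' := C1c_sqintegrable chiC'; have s2' := C1c_derive_sqintegrable chiC'.
have dE x : derive1 (fun x => chi (x - h)) x = derive1 chi (x - h).
  have [dchi _ _] := chiC.
  have dd : is_derive x 1 (fun x => chi (x - h)) (derive1 chi (x - h)).
    by apply: is_derive_addr; rewrite derive1E; exact: derivableP.
  by rewrite derive1E; have [_ ->] := dd.
have := H _ chiC'.
have := dot_shift h sf s2'; rewrite /dot => <-.
have := dot_shift h sg s1'; rewrite /dot => <- E.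
have -> : (fun x => f (x + h) * derive1 chi x) =
    (fun x => f (x + h) * derive1 (fun x => chi (x - h)) (x + h)).
  by apply/funext => x; rewrite dE addrK.
by rewrite E; congr (- _); apply: eq_Rintegral => x _; rewrite addrK.
Qed.

End real_weak_derivative_operations.

(** * The norms of L^2(R) and H^1(R) for complex-valued functions *)

Section complex_sobolev.
Context {R : realType}.
Local Notation leb := (@lebesgue_measure R).
Local Notation normc := (@Normc.normc R).
Local Notation Re := (@complex.Re R).
Local Notation Im := (@complex.Im R).
Implicit Types (f g k u v phi : R -> R[i]) (h c : R) (z w : R[i]).

Lemma L2norm_integral f : L2norm f =
  ((\int[leb]_x (Re (f x) ^+ 2 + Im (f x) ^+ 2)%:E) `^ 2^-1)%E.
Proof.
rewrite /L2norm unlock /=; congr (_ `^ _)%E; apply: eq_integral => x _ /=.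
by rewrite ger0_norm ?normc_ge0// powR_mulrn ?normc_ge0// sqr_normc.
Qed.

Lemma csqintegrable_integral f : csqintegrable f ->
  (\int[leb]_x (Re (f x) ^+ 2 + Im (f x) ^+ 2)%:E = (cdot f f)%:E)%E.
Proof.
move=> [f1 f2]; under eq_integral do rewrite EFinD.
rewrite ge0_integralD ?dot_integral// => [x _||x _|].
- by rewrite lee_fin sqr_ge0.
- by apply/measurable_EFinP; apply: measurable_funX; case: f1.
- by rewrite lee_fin sqr_ge0.
- by apply/measurable_EFinP; apply: measurable_funX; case: f2.
Qed.

Lemma L2normE f : csqintegrable f -> L2norm f = (cnorm f)%:E.
Proof.
by move=> f2; rewrite L2norm_integral csqintegrable_integral//= powR12_sqrt ?cdot_ge0.
Qed.

Lemma L2P f : L2 f <-> csqintegrable f.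
Proof.
split=> [[mr mi]|f2]; last first.
  by split; [case: f2 => -[]|case: f2 => _ []|rewrite L2normE// ltry].
rewrite L2norm_integral => fin.
have {}fin : (\int[leb]_x (Re (f x) ^+ 2 + Im (f x) ^+ 2)%:E < +oo)%E.
  by apply: lty_poweRy fin; rewrite invr_neq0.
have H : leb.-integrable setT (EFin \o (fun x => Re (f x) ^+ 2 + Im (f x) ^+ 2)).
  apply/integrableP; split.
    by apply/measurable_EFinP; apply: measurable_funD; exact: measurable_funX.
  under eq_integral do rewrite gee0_abs ?lee_fin ?addr_ge0 ?sqr_ge0//.
  exact: fin.
split; split=> //; apply: (le_integrable measurableT _ _ H).
- by apply/measurable_EFinP; exact: measurable_funX.
- by move=> x _; rewrite /= lee_fin !ger0_norm ?addr_ge0 ?sqr_ge0// lerDl sqr_ge0.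
- by apply/measurable_EFinP; exact: measurable_funX.
- by move=> x _; rewrite /= lee_fin !ger0_norm ?addr_ge0 ?sqr_ge0// lerDr sqr_ge0.
Qed.

Lemma weak_derivativeP f g : weak_derivative f g <->
  real_weak_derivative (fun x => Re (f x)) (fun x => Re (g x)) /\
  real_weak_derivative (fun x => Im (f x)) (fun x => Im (g x)).
Proof.
split; first by move=> H; split=> chi /H [].
by move=> [H1 H2] chi chiC; split; [exact: H1|exact: H2].
Qed.

(** The derivative is an explicit argument because the choice made by [Dx] commutes with
    differences, multiples and translations only almost everywhere. *)
Definition H1_derivative f g := [/\ csqintegrable f, csqintegrable g & weak_derivative f g].

Let fun_ReB f g : (fun x => Re ((f \- g) x)) = (fun x => Re (f x) - Re (g x)).
Proof. by apply/funext => x; exact: complex_ReB. Qed.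
Let fun_ImB f g : (fun x => Im ((f \- g) x)) = (fun x => Im (f x) - Im (g x)).
Proof. by apply/funext => x; exact: complex_ImB. Qed.
Let fun_ReZ c f : (fun x => Re (c%:C%C * f x)) = (fun x => c * Re (f x)).
Proof. by apply/funext => x; exact: complex_ReZ. Qed.
Let fun_ImZ c f : (fun x => Im (c%:C%C * f x)) = (fun x => c * Im (f x)).
Proof. by apply/funext => x; exact: complex_ImZ. Qed.

Lemma H1_derivativeB f1 g1 f2 g2 : H1_derivative f1 g1 -> H1_derivative f2 g2 ->
  H1_derivative (f1 \- f2) (g1 \- g2).
Proof.
move=> [sf1 sg1 /weak_derivativeP[a1 b1]] [sf2 sg2 /weak_derivativeP[a2 b2]].
split; [exact: csqintegrableB|exact: csqintegrableB|apply/weak_derivativeP; split].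
  rewrite !fun_ReB.
  by case: sf1 sg1 sf2 sg2 => [? ?] [? ?] [? ?] [? ?]; exact: real_weak_derivativeB.
rewrite !fun_ImB.
by case: sf1 sg1 sf2 sg2 => [? ?] [? ?] [? ?] [? ?]; exact: real_weak_derivativeB.
Qed.

Lemma H1_derivativeZ c f g : H1_derivative f g ->
  H1_derivative (fun x => c%:C%C * f x) (fun x => c%:C%C * g x).
Proof.
move=> [sf sg /weak_derivativeP[a b]].
split; [exact: csqintegrableZ|exact: csqintegrableZ|apply/weak_derivativeP; split].
  rewrite !fun_ReZ.
  by case: sf sg => [? ?] [? ?]; exact: real_weak_derivativeZ.
rewrite !fun_ImZ.
by case: sf sg => [? ?] [? ?]; exact: real_weak_derivativeZ.
Qed.

Lemma H1_derivative_shift h f g : H1_derivative f g ->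
  H1_derivative (fun x => f (x + h)) (fun x => g (x + h)).
Proof.
move=> [sf sg /weak_derivativeP[a b]].
split; [exact: csqintegrable_shift|exact: csqintegrable_shift|apply/weak_derivativeP].
by case: sf sg => [? ?] [? ?]; split;
  [exact: (real_weak_derivative_shift h (f := fun x => Re (f x)) (g := fun x => Re (g x)))
  |exact: (real_weak_derivative_shift h (f := fun x => Im (f x)) (g := fun x => Im (g x)))].
Qed.

Lemma H1_derivative_unique f g1 g2 : H1_derivative f g1 -> H1_derivative f g2 ->
  \forall x \ae leb, g1 x = g2 x.
Proof.
move=> [[s1 s2] [r1 i1] /weak_derivativeP[a1 b1]] [_ [r2 i2] /weak_derivativeP[a2 b2]].
apply: ae_imply2 (ae_weak_derivative_unique s1 r1 r2 a1 a2)
  (ae_weak_derivative_unique s2 i1 i2 b1 b2) => x.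
by case: (g1 x) (g2 x) => [? ?] [? ?] /= -> ->.
Qed.

Lemma H1_Dx f : H1 f -> H1_derivative f (Dx f).
Proof.
move=> [/L2P f2 [g [g2 fg]]].
have [/L2P ? ?] := @xgetPex _ (fun=> 0) [set g | L2 g /\ weak_derivative f g]
  (ex_intro _ g (conj g2 fg)).
by split.
Qed.

Lemma H1_derivative_H1 f g : H1_derivative f g -> H1 f.
Proof.
move=> [f2 g2 fg]; split; first exact/L2P.
by exists g; split => //; exact/L2P.
Qed.

Lemma ae_DxE f g : H1_derivative f g -> \forall x \ae leb, Dx f x = g x.
Proof.
move=> fg; have fDx := H1_Dx (H1_derivative_H1 fg).
exact: H1_derivative_unique fDx fg.
Qed.

Lemma cnorm_DxE f g : H1_derivative f g -> cnorm (Dx f) = cnorm g.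
Proof.
move=> fg; have [_ Dx2 _] := H1_Dx (H1_derivative_H1 fg).
by apply: eq_ae_cnorm => //; [case: fg|exact: ae_DxE].
Qed.

Lemma H1normE f g : H1_derivative f g ->
  H1norm f = (Num.sqrt (cnorm f ^+ 2 + cnorm g ^+ 2))%:E.
Proof.
move=> fg; have [f2 Dx2 _] := H1_Dx (H1_derivative_H1 fg).
rewrite /H1norm !L2normE// (cnorm_DxE fg) -!EFin_expe -EFinD poweR_EFin.
by rewrite powR12_sqrt// addr_ge0// sqr_ge0.
Qed.

Lemma H1norm_le f g c : H1_derivative f g -> 0 <= c ->
  (H1norm f <= c%:E)%E -> cnorm f <= c /\ cnorm g <= c.
Proof.
move=> fg c0; rewrite (H1normE fg) lee_fin => h.
have : cnorm f ^+ 2 + cnorm g ^+ 2 <= c ^+ 2.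
  by rewrite -[leLHS]sqr_sqrtr ?addr_ge0 ?sqr_ge0// ler_pXn2r// nnegrE sqrtr_ge0.
have := cnorm_ge0 f; have := cnorm_ge0 g => ? ? ?.
by split; rewrite -(@ler_pXn2r _ 2)// ?nnegrE//; nra.
Qed.

Lemma H1norm_ge f g c1 c2 : H1_derivative f g -> cnorm f <= c1 -> cnorm g <= c2 ->
  (H1norm f <= (c1 + c2)%:E)%E.
Proof.
move=> fg h1 h2; rewrite (H1normE fg) lee_fin.
have := cnorm_ge0 f; have := cnorm_ge0 g => ? ?.
rewrite -(@ler_pXn2r _ 2)// ?nnegrE ?sqrtr_ge0 ?addr_ge0//; try lra.
by rewrite sqr_sqrtr ?addr_ge0 ?sqr_ge0//; nra.
Qed.

Lemma cnorm_translate_sub_le f g h : H1_derivative f g -> 0 <= h ->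
  cnorm ((fun x => f (x + h)) \- f) <= h * cnorm g.
Proof.
move=> [[f1 f2] [g1 g2] /weak_derivativeP[a b]] h0.
rewrite -(@ler_pXn2r _ 2)// ?nnegrE ?mulr_ge0 ?cnorm_ge0// exprMn !sqr_cnorm /cdot.
rewrite fun_ReB fun_ImB mulrDr lerD//.
  exact: (dot_translate_sub_le f1 g1 a h0).
exact: (dot_translate_sub_le f2 g2 b h0).
Qed.

(** Real and imaginary parts are each bounded by [c], and the factor 2 comes from the crude estimate
    [c ^+ 2 + c ^+ 2 <= (2 * c) ^+ 2]. *)
Lemma cnorm_weak_derivative_le f g c : H1_derivative f g -> 0 <= c ->
  (forall n, cnorm ((fun x => f (x + n.+1%:R^-1)) \- f) <= n.+1%:R^-1 * c) ->
  cnorm g <= 2 * c.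
Proof.
move=> [[f1 f2] [g1 g2] /weak_derivativeP[a b]] c0 H.
have H' n : dot (fun x => Re (f (x + n.+1%:R^-1)) - Re (f x)) (fun x => Re (f (x + n.+1%:R^-1)) - Re (f x)) +
    dot (fun x => Im (f (x + n.+1%:R^-1)) - Im (f x)) (fun x => Im (f (x + n.+1%:R^-1)) - Im (f x)) <=
    (n.+1%:R^-1) ^+ 2 * c ^+ 2.
  have := H n; rewrite -(@ler_pXn2r _ 2)// ?nnegrE ?mulr_ge0 ?cnorm_ge0 ?invr_ge0//.
  rewrite exprMn sqr_cnorm /cdot.
  by rewrite fun_ReB fun_ImB.
have h1 : dot (fun x => Re (g x)) (fun x => Re (g x)) <= c ^+ 2.
  apply: (dot_weak_derivative_le f1 g1 a) => n; apply: le_trans (H' n).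
  by rewrite lerDl dot_ge0.
have h2 : dot (fun x => Im (g x)) (fun x => Im (g x)) <= c ^+ 2.
  apply: (dot_weak_derivative_le f2 g2 b) => n; apply: le_trans (H' n).
  by rewrite lerDr dot_ge0.
rewrite -(@ler_pXn2r _ 2)// ?nnegrE ?mulr_ge0 ?cnorm_ge0// exprMn sqr_cnorm /cdot.
by have := sqr_ge0 c; lra.
Qed.

Lemma ae_normc_le_sobolev f g : H1_derivative f g ->
  \forall x \ae leb, normc (f x) <= 2 * (cnorm f + cnorm g).
Proof.
move=> [[f1 f2] [g1 g2] /weak_derivativeP[a b]].
apply: ae_imply2 (ae_sqr_le_sobolev f1 g1 a) (ae_sqr_le_sobolev f2 g2 b) => x h1 h2.
have n1 := cnorm_ge0 f; have n2' := cnorm_ge0 g.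
rewrite -(@ler_pXn2r _ 2)// ?nnegrE ?mulr_ge0 ?normc_ge0 ?addr_ge0// sqr_normc.
have : cnorm f ^+ 2 + cnorm g ^+ 2 = cdot f f + cdot g g by rewrite !sqr_cnorm.
by rewrite /cdot; nra.
Qed.

Lemma Linftynorm_le f c : (\forall x \ae leb, normc (f x) <= c) -> 0 <= c ->
  (Linftynorm f <= c%:E)%E.
Proof.
move=> fc c0; rewrite /Linftynorm unlock; case: ifPn => // _.
apply/ess_supP; apply: ae_imply fc => x /= h.
by rewrite lee_fin ger0_norm ?normc_ge0.
Qed.

End complex_sobolev.

(** * The nonlinear terms *)
Section nonlinearity.
Context {R : realType}.
Local Notation leb := (@lebesgue_measure R).
Local Notation normc := (@Normc.normc R).
Local Notation Re := (@complex.Re R).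
Local Notation Im := (@complex.Im R).
Implicit Types (f g k u v phi : R -> R[i]) (h c : R) (z w : R[i]).

Lemma csqintegrable_ae_le f g c :
  measurable_fun setT (fun x => Re (f x)) -> measurable_fun setT (fun x => Im (f x)) ->
  csqintegrable g -> 0 <= c ->
  (\forall x \ae leb, normc (f x) <= c * normc (g x)) -> csqintegrable f.
Proof.
move=> mr mi g2 c0 fg; apply/L2P; split=> //.
rewrite L2norm_integral poweR_lty//.
have mg : measurable_fun setT (fun x => (Re (g x) ^+ 2 + Im (g x) ^+ 2)%:E).
  case: g2 => -[? _] [? _].
  by apply/measurable_EFinP; apply: measurable_funD; exact: measurable_funX.
apply: (@le_lt_trans _ _ ((c ^+ 2)%:E * (cdot g g)%:E)%E); last by rewrite -EFinM ltry.
rewrite -csqintegrable_integral// -ge0_integralZl//; last 2 first.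
- by move=> x _; rewrite lee_fin addr_ge0 ?sqr_ge0.
- by rewrite lee_fin sqr_ge0.
apply: ae_ge0_le_integral => //.
- by move=> x _; rewrite lee_fin addr_ge0 ?sqr_ge0.
- by apply/measurable_EFinP; apply: measurable_funD; exact: measurable_funX.
- by move=> x _; rewrite mule_ge0// lee_fin ?addr_ge0 ?sqr_ge0.
- exact: measurable_funeM.
- apply: ae_imply fg => x fgx _; rewrite -EFinM lee_fin -!sqr_normc -exprMn.
  by rewrite ler_pXn2r// nnegrE ?mulr_ge0 ?normc_ge0.
Qed.

Lemma normcD z w : normc (z + w) <= normc z + normc w.
Proof. by have := ler_normD z w; rewrite -lecR rmorphD. Qed.

Lemma normcB z w : normc (z - w) = normc (w - z).
Proof. by rewrite -opprB; case: (w - z) => a b /=; rewrite !sqrrN. Qed.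

Lemma normr_normcB z w : `|normc z - normc w| <= normc (z - w).
Proof.
rewrite ler_norml; apply/andP; split.
  rewrite lerNl opprB lerBlDr normcB.
  by apply: le_trans (normcD _ _); rewrite subrK.
by rewrite lerBlDr; apply: le_trans (normcD _ _); rewrite subrK.
Qed.

Lemma normcZ c z : normc (c%:C%C * z) = `|c| * normc z.
Proof. by rewrite Normc.normcM /= expr0n/= addr0 sqrtr_sqr. Qed.

Section power_nonlinearity.
Variables (p K gamma : R) (F : R -> R).
Hypotheses (p1 : 1 <= p) (K0 : 0 < K) (gamma0 : 0 < gamma).
Hypothesis F_lip : forall x y, 0 <= x -> 0 <= y ->
  `|F x - F y| <= K * (`|x| `^ (p - 1) + `|y| `^ (p - 1)) * `|x - y|.
Hypothesis F0 : F 0 = 0.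

(** With a = |z|^2 and b = |w|^2, the difference splits as gamma F(a) (z - w) + gamma (F(a) - F(b))
    w. Both a and b are at most m^2 eps^2, and [F] is Lipschitz there with constant [2 * K * P].
    Since [F 0 = 0], the first term is of order eps^2 |z - w|; so is the second, because |a - b| <=
    (|z| + |w|) |z - w|. *)
Lemma general_nonlinearity_lipschitz (m : R) : 0 < m ->
  exists L, 0 < L /\ forall eps z w, 0 < eps < 1 ->
    normc z <= m * eps -> normc w <= m * eps ->
    normc (general_nonlinearity gamma F z - general_nonlinearity gamma F w) <=
      L * eps ^+ 2 * normc (z - w).
Proof.
move=> m0; pose P := (m ^+ 2) `^ (p - 1).
have P0 : 0 < P by rewrite powR_gt0// exprn_gt0.
(* The term with z - w contributes 2, and the term with F(a) - F(b) contributes 4. As eps < 1 and p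
   >= 1, [P] bounds the powers in [F_lip] uniformly in eps. *)
exists (6 * gamma * K * P * m ^+ 2); split.
  by rewrite !mulr_gt0// exprn_gt0.
move=> eps z w /andP[e0 e1] zm wm; rewrite /general_nonlinearity.
set a := normc z ^+ 2; set b := normc w ^+ 2.
have z0 := normc_ge0 z; have w0 := normc_ge0 w; have d0 := normc_ge0 (z - w).
have me0 : 0 < m * eps by rewrite mulr_gt0.
have powP (y : R) : 0 <= y -> y <= m ^+ 2 -> `|y| `^ (p - 1) <= P.
  by move=> y0 ym; rewrite ger0_norm// ge0_ler_powR ?nnegrE ?subr_ge0 ?sqr_ge0.
have sqle (y : R) : 0 <= y -> y <= m * eps -> y ^+ 2 <= m ^+ 2 * eps ^+ 2.
  by move=> y0 ym; rewrite -exprMn ler_pXn2r// nnegrE ltW.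
have em : m ^+ 2 * eps ^+ 2 <= m ^+ 2.
  by rewrite ler_piMr ?sqr_ge0// expr_le1// ltW.
have a0 : 0 <= a by rewrite sqr_ge0.
have b0 : 0 <= b by rewrite sqr_ge0.
have am : a <= m ^+ 2 * eps ^+ 2 by exact: sqle.
have bm : b <= m ^+ 2 * eps ^+ 2 by exact: sqle.
have lip (x y : R) : 0 <= x -> x <= m ^+ 2 * eps ^+ 2 -> 0 <= y -> y <= m ^+ 2 * eps ^+ 2 ->
    `|F x - F y| <= 2 * K * P * `|x - y|.
  move=> x0 xm y0 ym; apply: (le_trans (F_lip x0 y0)); apply: ler_wpM2r => //.
  have -> : 2 * K * P = K * (P + P) by ring.
  by rewrite ler_wpM2l ?(ltW K0)// lerD// powP// (le_trans _ em).
have Fa : `|F a| <= 2 * K * P * (m ^+ 2 * eps ^+ 2).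
  have := lip a 0 a0 am (lexx _) (le_trans b0 bm); rewrite F0 !subr0 (ger0_norm a0).
  move=> /le_trans; apply; rewrite ler_wpM2l// !mulr_ge0// ltW//.
have ab : `|a - b| * normc w <= 2 * (m ^+ 2 * eps ^+ 2) * normc (z - w).
  have -> : a - b = (normc z - normc w) * (normc z + normc w) by rewrite /a /b; ring.
  rewrite normrM (ger0_norm (addr_ge0 z0 w0)).
  have h1 := normr_normcB z w.
  have h2 : (normc z + normc w) * normc w <= 2 * (m * eps) * (m * eps).
    by apply: ler_pM => //; rewrite ?addr_ge0//; lra.
  rewrite -[leLHS]mulrA; apply: (@le_trans _ _ (normc (z - w) * (2 * (m * eps) * (m * eps)))).
    have h5 : 0 <= (normc z + normc w) * normc w by rewrite mulr_ge0// addr_ge0.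
    exact: ler_pM.
  by rewrite le_eqVlt; apply/orP; left; apply/eqP; ring.
have -> : (gamma * F a)%:C%C * z - (gamma * F b)%:C%C * w =
    (gamma * F a)%:C%C * (z - w) + (gamma * (F a - F b))%:C%C * w.
  by rewrite mulrBr mulrBr rmorphB/= mulrBl addrA subrK.
apply: (le_trans (normcD _ _)); rewrite !normcZ !normrM (gtr0_norm gamma0).
have h3 : `|F a - F b| * normc w <= 2 * K * P * (2 * (m ^+ 2 * eps ^+ 2) * normc (z - w)).
  apply: (@le_trans _ _ (2 * K * P * `|a - b| * normc w)).
    by apply: ler_wpM2r => //; exact: lip.
  by rewrite -mulrA ler_wpM2l// !mulr_ge0// ltW.
have h4 : `|F a| * normc (z - w) <= 2 * K * P * (m ^+ 2 * eps ^+ 2) * normc (z - w).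
  by apply: ler_wpM2r.
have -> : 6 * gamma * K * P * m ^+ 2 * eps ^+ 2 * normc (z - w) =
  gamma * (2 * K * P * (m ^+ 2 * eps ^+ 2) * normc (z - w) +
           2 * K * P * (2 * (m ^+ 2 * eps ^+ 2) * normc (z - w))) by ring.
rewrite -!(mulrA gamma) -mulrDr.
by rewrite ler_wpM2l ?lerD// ltW.
Qed.

Hypothesis dF : forall x, 0 <= x -> derivable F x 1.

Lemma measurable_general_nonlinearity u : csqintegrable u ->
  measurable_fun setT (fun x => Re (general_nonlinearity gamma F (u x))) /\
  measurable_fun setT (fun x => Im (general_nonlinearity gamma F (u x))).
Proof.
move=> [[mr _] [mi _]].
(* [F] is known to be regular on nonnegative arguments only; truncation makes it continuous on the
   whole line without changing its values at squared moduli. *)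
have cF : continuous (fun y : R => F (Num.max 0 y)).
  move=> y; apply: (continuous_comp (f := fun y : R => Num.max 0 y) (g := F)).
    by apply: continuous_max; [exact: cvg_cst|exact: cvg_id].
  by apply/differentiable_continuous/derivable1_diffP/dF; rewrite le_max lexx.
have mF : measurable_fun setT (fun x => gamma * F (normc (u x) ^+ 2)).
  have -> : (fun x => gamma * F (normc (u x) ^+ 2)) =
     (fun x => gamma * (fun y : R => F (Num.max 0 y)) (Re (u x) ^+ 2 + Im (u x) ^+ 2)).
    by apply/funext => x; rewrite sqr_normc /= max_r// addr_ge0 ?sqr_ge0.
  apply: measurable_funM; first exact: measurable_cst.
  apply: (measurableT_comp (f := fun y : R => F (Num.max 0 y))
    (g := fun x => Re (u x) ^+ 2 + Im (u x) ^+ 2)).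
    exact: continuous_measurable_fun.
  by apply: measurable_funD; exact: measurable_funX.
split.
  by under eq_fun do rewrite /general_nonlinearity complex_ReZ; exact: measurable_funM.
by under eq_fun do rewrite /general_nonlinearity complex_ImZ; exact: measurable_funM.
Qed.

End power_nonlinearity.

End nonlinearity.

(** * Forced linear flows *)
Section evolution.
Context {R : realType}.
Local Notation leb := (@lebesgue_measure R).
Implicit Types (w dw f : R -> R -> R[i]) (phi dphi : R -> R[i]) (h c nu t s e d : R).

Definition timesi phi : R -> R[i] := fun x => 'i%C * phi x.

(* A forced linear Schroedinger flow i w_t + nu w_xx + f = 0 with values in
   H^1(R), in the real Hilbert space L^2(R; C): there, w_t pairs with phi to
   <i f, phi> - nu <i w_x, phi_x>. *)
Definition schroedinger_flow nu w dw f : Prop :=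
  [/\ forall t, 0 <= t -> H1_derivative (w t) (dw t),
      forall t, 0 <= t -> csqintegrable (f t),
      forall t e, 0 <= t -> 0 < e -> exists2 d, 0 < d & forall s, 0 <= s ->
        `|s - t| < d -> cnorm (w s \- w t) <= e /\ cnorm (dw s \- dw t) <= e &
      forall t e, 0 < t -> 0 < e -> exists2 d, 0 < d & forall s, 0 <= s ->
        `|s - t| < d -> forall phi dphi, H1_derivative phi dphi ->
        `|cdot (w s \- w t) phi -
          (s - t) * (cdot (timesi (f t)) phi - nu * cdot (timesi (dw t)) dphi)|
        <= e * `|s - t| * (cnorm phi + cnorm dphi)].

Lemma schroedinger_flowB nu w1 dw1 f1 w2 dw2 f2 :
  schroedinger_flow nu w1 dw1 f1 -> schroedinger_flow nu w2 dw2 f2 ->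
  schroedinger_flow nu (fun t => w1 t \- w2 t) (fun t => dw1 t \- dw2 t)
    (fun t => f1 t \- f2 t).
Proof.
move=> [h1 s1 c1 d1] [h2 s2 c2 d2].
have subE (a b a' b' : R -> R[i]) : (a \- b) \- (a' \- b') = (a \- a') \- (b \- b').
  by apply/funext => x /=; ring.
have iE (a b : R -> R[i]) : timesi (a \- b) = timesi a \- timesi b.
  by apply/funext => x; rewrite /timesi/= mulrBr.
split.
- by move=> t t0; apply: H1_derivativeB; [exact: h1|exact: h2].
- by move=> t t0; apply: csqintegrableB; [exact: s1|exact: s2].
- move=> t e t0 e0; have e2 : 0 < e / 2 by rewrite divr_gt0.
  have [r1 r10 H1] := c1 t _ t0 e2; have [r2 r20 H2] := c2 t _ t0 e2.
  exists (Num.min r1 r2); first by rewrite lt_min r10.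
  move=> s s0; rewrite lt_min => /andP[l1 l2].
  have [a1 b1] := H1 s s0 l1; have [a2 b2] := H2 s s0 l2.
  have [q1 q2 _] := h1 s s0; have [q3 q4 _] := h2 s s0.
  have [q5 q6 _] := h1 t t0; have [q7 q8 _] := h2 t t0.
  rewrite (subE (w1 s)) (subE (dw1 s)); split.
    apply: (le_trans (cnormB (csqintegrableB q1 q5) (csqintegrableB q3 q7))); lra.
  apply: (le_trans (cnormB (csqintegrableB q2 q6) (csqintegrableB q4 q8))); lra.
- move=> t e t0 e0; have e2 : 0 < e / 2 by rewrite divr_gt0.
  have [r1 r10 H1] := d1 t _ t0 e2; have [r2 r20 H2] := d2 t _ t0 e2.
  exists (Num.min r1 r2); first by rewrite lt_min r10.
  move=> s s0; rewrite lt_min => /andP[l1 l2] phi dphi H.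
  have := H1 s s0 l1 _ _ H; have := H2 s s0 l2 _ _ H.
  have [p1 p2 _] := H.
  have [q1 _ _] := h1 s s0; have [q3 _ _] := h2 s s0.
  have [q5 q6 _] := h1 t (ltW t0); have [q7 q8 _] := h2 t (ltW t0).
  have i1 := csqintegrable_iM (s1 t (ltW t0)); have i2 := csqintegrable_iM (s2 t (ltW t0)).
  have j1 := csqintegrable_iM q6; have j2 := csqintegrable_iM q8.
  rewrite subE !iE.
  rewrite (cdotBl (csqintegrableB q1 q5) (csqintegrableB q3 q7) p1).
  rewrite (cdotBl i1 i2 p1) (cdotBl j1 j2 p2).
  rewrite -!/(timesi _) => b2 b1.
  move: b1 b2; move: (cdot (w1 s \- w1 t) phi) (cdot (w2 s \- w2 t) phi).
  move: (cdot (timesi (f1 t)) phi) (cdot (timesi (f2 t)) phi).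
  move: (cdot (timesi (dw1 t)) dphi) (cdot (timesi (dw2 t)) dphi).
  move: (cnorm phi + cnorm dphi) `|s - t| (s - t) => x1 x2 x3 x4 x5 x6 x7 x8 x9.
  rewrite !ler_norml => /andP[b1 b1'] /andP[b2 b2'].
  by apply/andP; split; lra.
Qed.

(** The equation has constant coefficients: testing the shifted flow with [phi] amounts to testing
    the flow with [phi] translated by [- h]. *)
Lemma schroedinger_flow_shift h nu w dw f : schroedinger_flow nu w dw f ->
  schroedinger_flow nu (fun t x => w t (x + h)) (fun t x => dw t (x + h))
    (fun t x => f t (x + h)).
Proof.
move=> [h1 s1 c1 d1]; split.
- by move=> t t0; apply: H1_derivative_shift; exact: h1.
- by move=> t t0; apply: csqintegrable_shift; exact: s1.
- move=> t e t0 e0; have [r r0 H] := c1 t e t0 e0; exists r => // s s0 st.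
  have [q1 q2 _] := h1 s s0; have [q5 q6 _] := h1 t t0.
  have := H s s0 st.
  by rewrite -(cnorm_shift h (csqintegrableB q1 q5)) -(cnorm_shift h (csqintegrableB q2 q6)).
- move=> t e t0 e0; have [r r0 H] := d1 t e t0 e0; exists r => // s s0 st phi dphi P.
  have [q1 q2 _] := h1 s s0; have [q5 q6 _] := h1 t (ltW t0).
  have P' := H1_derivative_shift (- h) P.
  have [p1 p2 _] := P; have [p1' p2' _] := P'.
  have := H s s0 st _ _ P'.
  rewrite !(cnorm_shift (- h))//.
  rewrite -(cdot_shift h (csqintegrableB q1 q5) p1').
  rewrite -(cdot_shift h (csqintegrable_iM (s1 t (ltW t0))) p1').
  rewrite -(cdot_shift h (csqintegrable_iM q6) p2').
  have addK (g : R -> R[i]) : (fun x => g (x + h - h)) = g.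
    by apply/funext => x; rewrite addrK.
  by rewrite !addK.
Qed.

(** With D = w(s) - w(t), the increment of the energy is <D, w(s)> + <D, w(t)>, and the expansion of
    the flow at [t] is tested with both functions. Skewness removes <i w_x(t), w_x(t)>; what remains
    of the dispersive term is <i w_x(t), w_x(s) - w_x(t)>, which is small because w_x is continuous
    in time with values in L^2(R). *)
Lemma schroedinger_flow_energy nu w dw f t : schroedinger_flow nu w dw f -> 0 <= nu -> 0 < t ->
  is_derive t 1 (fun t => cdot (w t) (w t)) (2 * cdot (timesi (f t)) (w t)).
Proof.
move=> [h1 s1 c1 d1] nu0 t0; have t0' := ltW t0.
have [wt2 dwt2 _] := h1 t t0'.
have ft2 := csqintegrable_iM (s1 t t0'); have idwt2 := csqintegrable_iM dwt2.
pose a := cnorm (w t) + cnorm (dw t).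
pose b := cnorm (f t) + nu * cnorm (dw t).
have a0 : 0 <= a by rewrite addr_ge0 ?cnorm_ge0.
have b0 : 0 <= b by rewrite addr_ge0 ?mulr_ge0 ?cnorm_ge0.
(* [2 * a + 2] bounds the norms of the two test functions, those at time [s] exceeding those at time
   [t] by at most [e' <= 1] each; [b] accounts for the increments of [w] and [dw] in the right-hand
   side. *)
pose Q := 2 * a + 2 + b.
have Q0 : 0 < Q by rewrite /Q; lra.
apply: is_derive_remainder => e e0.
pose e' := Num.min 1 (e / Q).
have e'0 : 0 < e' by rewrite lt_min ltr01 divr_gt0.
have e'1 : e' <= 1 by rewrite ge_min lexx.
have e'Q : e' * Q <= e by rewrite -ler_pdivlMr// ge_min lexx orbT.
have [r1 r10 H1] := c1 t e' t0' e'0; have [r2 r20 H2] := d1 t e' t0 e'0.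
(* The bound by [t] keeps the time [h + t] nonnegative. *)
exists (Num.min t (Num.min r1 r2)); first by rewrite !lt_min t0 r10.
move=> h; rewrite !lt_min => /and3P[ht hr1 hr2].
have s0 : 0 <= h + t by move: ht; rewrite ltr_norml => /andP[]; lra.
set s := h + t in s0 *.
have sth : s - t = h by rewrite /s addrK.
have [w2 dws2 _] := h1 s s0.
have [n1 n1'] := H1 s s0 (eq_ind_r (fun z => `|z| < r1) hr1 sth).
have := H2 s s0 (eq_ind_r (fun z => `|z| < r2) hr2 sth).
rewrite sth => H2'; have E1 := H2' _ _ (h1 s s0); have E2 := H2' _ _ (h1 t t0').
pose D := w s \- w t; pose dD := dw s \- dw t.
have D2 : csqintegrable D by exact: csqintegrableB.
have dD2 : csqintegrable dD by exact: csqintegrableB.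
have wsE : w s = w t \+ D by apply/funext => x; rewrite /D /= addrC subrK.
have dwsE : dw s = dw t \+ dD by apply/funext => x; rewrite /dD /= addrC subrK.
have i1 : cdot (timesi (f t)) (w s) = cdot (timesi (f t)) (w t) + cdot (timesi (f t)) D.
  by rewrite {1}wsE cdotDr.
have i2 : cdot (timesi (dw t)) (dw s) = cdot (timesi (dw t)) dD.
  by rewrite {1}dwsE cdotDr// cdot_iM_self// add0r.
have j1 : `|cdot (timesi (f t)) D| <= cnorm (f t) * e'.
  apply: (le_trans (normr_cdot_le ft2 D2)); rewrite cnorm_iM//; last exact: s1.
  by rewrite ler_wpM2l ?cnorm_ge0.
have j2 : `|cdot (timesi (dw t)) dD| <= cnorm (dw t) * e'.
  apply: (le_trans (normr_cdot_le idwt2 dD2)); rewrite cnorm_iM//.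
  by rewrite ler_wpM2l ?cnorm_ge0.
have ns : cnorm (w s) <= cnorm (w t) + e'.
  by rewrite {1}wsE; apply: (le_trans (cnormD wt2 D2)); rewrite lerD2l.
have nds : cnorm (dw s) <= cnorm (dw t) + e'.
  by rewrite {1}dwsE; apply: (le_trans (cnormD dwt2 dD2)); rewrite lerD2l.
have -> : cdot (w s) (w s) - cdot (w t) (w t) = cdot D (w s) + cdot D (w t).
  by rewrite !cdotBl// [cdot (w t) (w s)]cdotC; ring.
rewrite i1 i2 in E1; rewrite cdot_iM_self// mulr0 subr0 in E2.
have -> : cdot D (w s) + cdot D (w t) - h * (2 * cdot (timesi (f t)) (w t)) =
  (cdot D (w s) - h * (cdot (timesi (f t)) (w t) + cdot (timesi (f t)) D - nu * cdot (timesi (dw t)) dD))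
  + (cdot D (w t) - h * cdot (timesi (f t)) (w t))
  + h * (cdot (timesi (f t)) D - nu * cdot (timesi (dw t)) dD) by ring.
apply: (@le_trans _ _ (`|h| * (e' * Q))); last by rewrite mulrC ler_wpM2r.
apply: (le_trans (ler_normD _ _)).
have h0 := normr_ge0 h.
have k3 : `|h * (cdot (timesi (f t)) D - nu * cdot (timesi (dw t)) dD)| <= `|h| * (e' * b).
  rewrite normrM ler_wpM2l//; apply: (le_trans (ler_normB _ _)).
  rewrite normrM (ger0_norm nu0) /b.
  have : nu * `|cdot (timesi (dw t)) dD| <= nu * (cnorm (dw t) * e') by rewrite ler_wpM2l.
  by lra.
have k1 := le_trans (ler_normD _ _) (lerD E1 E2).
have k2 : e' * `|h| * (cnorm (w s) + cnorm (dw s)) + e' * `|h| * (cnorm (w t) + cnorm (dw t)) <=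
    `|h| * (e' * (2 * a + 2)).
  have k : cnorm (w s) + cnorm (dw s) + (cnorm (w t) + cnorm (dw t)) <= 2 * a + 2.
    rewrite /a; move: ns nds e'1.
    move: (cnorm (w s)) (cnorm (dw s)) (cnorm (w t)) (cnorm (dw t)) => x1 x2 x3 x4; lra.
  rewrite -mulrDr [e' * _]mulrC -mulrA; apply: ler_wpM2l => //.
  by apply: ler_wpM2l => //; exact: ltW.
apply: (le_trans (lerD (le_trans k1 k2) k3)).
by rewrite -mulrDr -mulrDr /Q.
Qed.

(** By the energy identity and Cauchy-Schwarz, the norm has slope at most [B]; the mean value
    theorem integrates this. *)
Lemma schroedinger_flow_le nu w dw f (B : R) t : schroedinger_flow nu w dw f -> 0 <= nu ->
  (forall s, 0 <= s -> cnorm (f s) <= B) -> 0 <= t -> cnorm (w t) <= cnorm (w 0) + t * B.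
Proof.
move=> fl nu0 fB; rewrite le_eqVlt => /orP[/eqP <-|t0]; first by rewrite mul0r addr0.
have [h1 s1 c1 _] := fl.
have B0 : 0 <= B := le_trans (cnorm_ge0 _) (fB 0 (lexx 0)).
(* The energy is differentiated at positive times only, so continuity at 0 is shown separately; the
   absolute value extends the flow to a two-sided neighbourhood of 0. *)
have cont0 : {for 0, continuous (fun s => cdot (w `|s|) (w `|s|))}.
  apply/cvgrPdist_le => e e0.
  have [w02 _ _] := h1 0 (lexx 0).
  pose Q := 2 * cnorm (w 0) + 1.
  have Q0 : 0 < Q by rewrite /Q; have := cnorm_ge0 (w 0); lra.
  pose e' := Num.min 1 (e / Q).
  have e'0 : 0 < e' by rewrite lt_min ltr01 divr_gt0.
  have e'1 : e' <= 1 by rewrite ge_min lexx.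
  have e'Q : e' * Q <= e by rewrite -ler_pdivlMr// ge_min lexx orbT.
  have [r r0 H] := c1 0 e' (lexx 0) e'0.
  near=> s; rewrite normr0 distrC.
  have [ws2 _ _] := h1 `|s| (normr_ge0 s).
  have [n1 _] : cnorm (w `|s| \- w 0) <= e' /\ cnorm (dw `|s| \- dw 0) <= e'.
    apply: H => //; rewrite subr0 normr_id.
    by near: s; exists r => //= y; rewrite /ball_/= sub0r normrN.
  have D2 := csqintegrableB ws2 w02.
  have wsE : w `|s| = w 0 \+ (w `|s| \- w 0) by apply/funext => x; rewrite /= addrC subrK.
  have ns : cnorm (w `|s|) <= cnorm (w 0) + e'.
    by rewrite {1}wsE; apply: (le_trans (cnormD w02 D2)); rewrite lerD2l.
  have -> : cdot (w `|s|) (w `|s|) - cdot (w 0) (w 0) =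
      cdot (w `|s| \- w 0) (w `|s|) + cdot (w `|s| \- w 0) (w 0).
    by rewrite !cdotBl// [cdot (w 0) (w `|s|)]cdotC; ring.
  apply: (le_trans (ler_normD _ _)); apply: le_trans e'Q.
  apply: (le_trans (lerD (normr_cdot_le D2 ws2) (normr_cdot_le D2 w02))).
  rewrite -mulrDr; apply: ler_pM; rewrite ?cnorm_ge0 ?addr_ge0 ?cnorm_ge0// /Q; lra.
apply/ler_addgt0Pr => d d0.
(* The norm itself may fail to be differentiable where [w s] vanishes. This regularisation is
   differentiable at positive times, dominates the norm, and exceeds it at time 0 by at most [d],
   which is arbitrary. *)
pose G s := Num.sqrt (cdot (w s) (w s) + d ^+ 2).
have d20 : 0 < d ^+ 2 by rewrite exprn_gt0.
have pos s : 0 < cdot (w s) (w s) + d ^+ 2 by rewrite ltr_wpDl ?cdot_ge0.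
have dG s : 0 < s -> is_derive s 1 G ((2 * G s)^-1 * (2 * cdot (timesi (f s)) (w s))).
  move=> s0.
  have D1 := schroedinger_flow_energy fl nu0 s0.
  have D2 : is_derive s 1 (fun t => cdot (w t) (w t) + d ^+ 2) (2 * cdot (timesi (f s)) (w s)).
    by apply: is_derive_eq (addr0 _).
  exact: (@is_derive1_comp R Num.sqrt (fun t => cdot (w t) (w t) + d ^+ 2) s _ _
    (is_derive1_sqrt (pos s)) D2).
have cG s : 0 < s -> {for s, continuous G}.
  move=> s0; apply/differentiable_continuous/derivable1_diffP.
  by have [] := dG s s0.
have cG0 : G s @[s --> 0^'+] --> G 0.
  pose G' s := Num.sqrt (cdot (w `|s|) (w `|s|) + d ^+ 2).
  have cG' : {for 0, continuous G'}.
    apply: (continuous_comp (f := fun s => cdot (w `|s|) (w `|s|) + d ^+ 2) (g := Num.sqrt)).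
      by apply: cvgD; [exact: cont0|exact: cvg_cst].
    exact: sqrt_continuous.
  have -> : G 0 = G' 0 by rewrite /G' normr0.
  have G'0 : G' s @[s --> 0^'+] --> G' 0 by apply: cvg_at_right_filter; exact: cG'.
  apply: cvg_trans; last exact: G'0.
  apply: near_eq_cvg; near=> s.
  by rewrite /G /G' gtr0_norm.
have cGt : {within `[0, t], continuous G}.
  apply/continuous_within_itvP => //; split => //.
    by move=> s; rewrite in_itv/= => /andP[s0 _]; exact: cG.
  by apply: cvg_at_left_filter; exact: cG.
have [c] := @MVT R G (fun s => (2 * G s)^-1 * (2 * cdot (timesi (f s)) (w s))) 0 t t0
  (fun s (hs : s \in `]0, t[) => dG s (proj1 (andP hs))) cGt.
rewrite in_itv/= => /andP[c0 ct]; rewrite subr0 => GE.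
have [wc2 _ _] := h1 c (ltW c0).
have Gc0 : 0 < G c by rewrite sqrtr_gt0.
have le_G s : cnorm (w s) <= G s by rewrite ler_sqrt ?lerDl ?ltW.
have dGc : (2 * G c)^-1 * (2 * cdot (timesi (f c)) (w c)) <= B.
  rewrite invfM mulrACA mulVf// mul1r ler_pdivrMl// mulrC.
  have := normr_cdot_le (csqintegrable_iM (s1 c (ltW c0))) wc2.
  rewrite cnorm_iM; last exact: s1 (ltW c0).
  move=> /ler_normlW /le_trans; apply.
  by apply: ler_pM; rewrite ?cnorm_ge0 ?fB// ltW.
have G0 : G 0 <= cnorm (w 0) + d.
  rewrite -(@ler_pXn2r _ 2)// ?nnegrE ?sqrtr_ge0 ?addr_ge0 ?cnorm_ge0 ?(ltW d0)//.
  rewrite /G sqr_sqrtr ?(ltW (pos 0))// -sqr_cnorm.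
  by have := mulr_ge0 (cnorm_ge0 (w 0)) (ltW d0); move: (cnorm (w 0)) => y; lra.
have : (2 * G c)^-1 * (2 * cdot (timesi (f c)) (w c)) * t <= t * B.
  by rewrite mulrC ler_wpM2l// ltW.
rewrite -GE => k; have := le_G t; lra.
Unshelve. all: by end_near. Qed.

End evolution.

(** * Solutions of the equations as forced linear flows *)

Section solutions.
Context {R : realType}.
Local Notation leb := (@lebesgue_measure R).
Local Notation normc := (@Normc.normc R).
Local Notation Re := (@complex.Re R).
Local Notation Im := (@complex.Im R).
Implicit Types (f g phi dphi : R -> R[i]) (h c nu t s e d : R) (z : R[i]).

Lemma normr_Re_le z : `|Re z| <= normc z.
Proof.
rewrite -(@ler_pXn2r _ 2)// ?nnegrE ?normc_ge0// sqr_normc real_normK ?num_real//.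
by rewrite lerDl sqr_ge0.
Qed.

Lemma Re_L2dot f g : csqintegrable f -> csqintegrable g -> Re (L2dot f g) = cdot f g.
Proof.
move=> [f1 f2] [g1 g2]; rewrite /L2dot/= /cdot /dot -RintegralD//; try exact: sqintegrable_mul.
apply: eq_Rintegral => x _; case: (f x) (g x) => [a b] [a' b'] /=.
by rewrite mulrN opprK.
Qed.

Lemma Im_L2dot f g : csqintegrable f -> csqintegrable g ->
  Im (L2dot f g) = - cdot (timesi f) g.
Proof.
move=> sf sg; rewrite cdot_iMl// opprB; case: sf sg => [f1 f2] [g1 g2].
rewrite /L2dot/= /dot -RintegralB//; try exact: sqintegrable_mul.
apply: eq_Rintegral => x _; case: (f x) (g x) => [a b] [a' b'] /=.
by rewrite mulrN addrC.
Qed.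

Lemma eq_ae_cdotr f g1 g2 : csqintegrable f -> csqintegrable g1 -> csqintegrable g2 ->
  (\forall x \ae leb, g1 x = g2 x) -> cdot f g1 = cdot f g2.
Proof.
move=> [[f1 _] [f2 _]] [[a1 _] [a2 _]] [[b1 _] [b2 _]] E.
by rewrite /cdot; congr (_ + _); apply: eq_ae_dot => //;
  first [by apply: ae_imply E => x -> | exact: aeW].
Qed.

Lemma cnormZ c f : csqintegrable f -> 0 <= c -> cnorm (fun x => c%:C%C * f x) = c * cnorm f.
Proof.
move=> sf c0; have scf := csqintegrableZ c sf.
rewrite /cnorm cdotZl// cdotZr// mulrA -expr2 sqrtrM ?sqr_ge0// sqrtr_sqr ger0_norm//.
Qed.

(** The H^-1 norm controls test functions in the unit ball of H^1(R), so [phi] is rescaled into that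
    ball; the equation then expresses the real part of [ut t] in terms of [u t]. *)
Lemma global_H1_solution_flow nu (N : R[i] -> R[i]) (u0 : R -> R[i]) (u : R -> R -> R[i]) :
  global_H1_solution nu N u0 u ->
  (forall t, 0 <= t -> csqintegrable (fun x => N (u t x))) ->
  schroedinger_flow nu u (fun t => Dx (u t)) (fun t x => N (u t x)).
Proof.
move=> [uH1 ucont [ut utP] _] sN.
have uD t : 0 <= t -> H1_derivative (u t) (Dx (u t)) by move=> /uH1/H1_Dx.
split=> //.
- move=> t e t0 e0.
  have e0' : (0 < e%:E)%E by rewrite lte_fin.
  have /nbhs_ballP[d /= d0 Hd] := ucont t t0 _ (open_ereal_lt' e0').
  exists d => // s s0 st.
  have Hs : (H1norm (u s \- u t) < e%:E)%E by apply: Hd => //; rewrite /ball/= distrC.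
  exact: (H1norm_le (H1_derivativeB (uD s s0) (uD t t0)) (ltW e0) (ltW Hs)).
- move=> t e t0 e0.
  have e0' : (0 < e%:E)%E by rewrite lte_fin.
  have [cq _ eqn] := utP t (ltW t0).
  have /nbhs_ballP[d /= d0 Hd] := cq _ (open_ereal_lt' e0').
  exists d => // s s0 st phi dphi P.
  have [p1 p2 _] := P.
  have [ut1 ut2 _] := uD t (ltW t0); have [us1 _ _] := uD s s0.
  have sNt := sN t (ltW t0).
  have D2 := csqintegrableB us1 ut1.
  have i1 := csqintegrable_iM sNt; have i2 := csqintegrable_iM ut2.
  (* The difference quotient is controlled on a punctured neighbourhood only. *)
  have [->|sneqt] := eqVneq s t.
    by rewrite cdotBl// !subrr mul0r subr0 normr0 mulr0 mul0r.
  have r0 : 0 <= cnorm phi + cnorm dphi by rewrite addr_ge0 ?cnorm_ge0.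
  (* A test function of norm zero cannot be normalised, but all its pairings vanish by
     Cauchy-Schwarz. *)
  have [r00|rn0] := eqVneq (cnorm phi + cnorm dphi) 0.
    have [n1 n1'] : cnorm phi = 0 /\ cnorm dphi = 0.
      by have := cnorm_ge0 phi; have := cnorm_ge0 dphi; lra.
    have z1 : cdot (u s \- u t) phi = 0.
      by apply/eqP; rewrite -normr_le0 (le_trans (normr_cdot_le D2 p1))// n1 mulr0.
    have z2 : cdot (timesi (fun x => N (u t x))) phi = 0.
      by apply/eqP; rewrite -normr_le0 (le_trans (normr_cdot_le i1 p1))// n1 mulr0.
    have z3 : cdot (timesi (Dx (u t))) dphi = 0.
      by apply/eqP; rewrite -normr_le0 (le_trans (normr_cdot_le i2 p2))// n1' mulr0.
    by rewrite r00 z1 z2 z3 !mulr0 subr0 mulr0 subr0 normr0.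
  set r := cnorm phi + cnorm dphi in r0 rn0 *.
  have rp : 0 < r by rewrite lt_neqAle eq_sym rn0.
  have rV0 : 0 <= r^-1 by rewrite invr_ge0.
  pose phi' : R -> R[i] := fun x => (r^-1)%:C%C * phi x.
  pose dphi' : R -> R[i] := fun x => (r^-1)%:C%C * dphi x.
  have P' : H1_derivative phi' dphi' by exact: H1_derivativeZ.
  have [q1 q2 _] := P'; have phiH1 := H1_derivative_H1 P'.
  have [_ Dx2 _] := H1_Dx phiH1.
  have phi1 : (H1norm phi' <= 1)%E.
    have -> : 1%E = (cnorm phi' + cnorm dphi')%:E.
      by rewrite !cnormZ// -mulrDr mulVf.
    exact: (H1norm_ge P').
  have Hs : (Hm1norm (fun phi => (((s - t)^-1)%:C%C * L2dot (u s \- u t) phi - ut t phi)%R) < e%:E)%E.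
    by apply: Hd => //; rewrite /ball/= distrC.
  have : ((normc (((s - t)^-1)%:C%C * L2dot (u s \- u t) phi' - ut t phi')%R)%:E <= e%:E)%E.
    by apply: le_trans (ltW Hs); apply: ereal_sup_ubound; exists phi'.
  rewrite lee_fin => /(le_trans (normr_Re_le _)).
  rewrite complex_ReB complex_ReZ Re_L2dot//.
  (* This is the imaginary part of the equation, since [ut] is multiplied by i there. [Dx phi'] may
     be replaced by [dphi'], as both agree almost everywhere. *)
  have -> : Re (ut t phi') = cdot (timesi (fun x => N (u t x))) phi' -
      nu * cdot (timesi (Dx (u t))) dphi'.
    have := congr1 Im (eqn phi' phiH1).
    rewrite complex_ImD complex_ImB complex_Im_iM complex_ImZ !Im_L2dot//=.
    by rewrite (eq_ae_cdotr i2 Dx2 q2 (ae_DxE P')); lra.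
  rewrite !cdotZr// => H.
  have st0 : 0 < `|s - t| by rewrite normr_gt0 subr_eq0.
  have -> : cdot (u s \- u t) phi - (s - t) * (cdot (timesi (fun x => N (u t x))) phi -
      nu * cdot (timesi (Dx (u t))) dphi) =
    (s - t) * r * ((s - t)^-1 * (r^-1 * cdot (u s \- u t) phi) -
      (r^-1 * cdot (timesi (fun x => N (u t x))) phi -
       nu * (r^-1 * cdot (timesi (Dx (u t))) dphi))).
    by field; rewrite subr_eq0 sneqt rn0.
  have -> : e * `|s - t| * r = `|(s - t) * r| * e by rewrite normrM (gtr0_norm rp); ring.
  by rewrite normrM ler_wpM2l.
Qed.

End solutions.

(** * Closeness of the solutions *)
Section closeness.
Context {R : realType}.
Local Notation leb := (@lebesgue_measure R).
Local Notation normc := (@Normc.normc R).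
Local Notation Re := (@complex.Re R).
Local Notation Im := (@complex.Im R).
Implicit Types (M nu c L eps h t B C T : R) (N : R[i] -> R[i])
  (u U w dw f : R -> R -> R[i]).

(** The radius [4 * (M * c) * eps] is the Sobolev bound for u(t): a factor 2 times the sum of two
    norms, each at most [M * c * eps]. The forcing is bounded by comparing [N] with [N 0 = 0], its
    increments by [cnorm_translate_sub_le]; the same constant occurs in both because [u] and its
    derivative obey the same bound. *)
Lemma bounded_solution_forcing M nu N (u0 : R -> R[i]) u c L eps :
  0 < M -> 0 < c -> 0 < L -> 0 < eps -> N 0 = 0 ->
  (forall v, csqintegrable v -> measurable_fun setT (fun x => Re (N (v x))) /\
     measurable_fun setT (fun x => Im (N (v x)))) ->
  (forall z z', normc z <= 4 * (M * c) * eps -> normc z' <= 4 * (M * c) * eps ->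
     normc (N z - N z') <= L * eps ^+ 2 * normc (z - z')) ->
  H1 u0 -> (H1norm u0 <= (c * eps)%:E)%E -> bounded_global_H1_solution M nu N u0 u ->
  [/\ schroedinger_flow nu u (fun t => Dx (u t)) (fun t x => N (u t x)),
      forall t, 0 <= t -> cnorm (fun x => N (u t x)) <= L * (M * c) * eps ^+ 3 &
      forall t h, 0 <= t -> 0 <= h ->
        cnorm ((fun x => N (u t (x + h))) \- (fun x => N (u t x))) <=
          h * (L * (M * c) * eps ^+ 3)].
Proof.
move=> M0 c0 L0 e0 N0 mN lipN u0H1 u0le [sol bnd].
have b0 : 0 < M * c * eps by rewrite !mulr_gt0.
have uH t : 0 <= t -> H1_derivative (u t) (Dx (u t)) by case: sol => H _ _ _ /H/H1_Dx.
have un t : 0 <= t -> cnorm (u t) <= M * c * eps /\ cnorm (Dx (u t)) <= M * c * eps.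
  move=> t0; apply: (H1norm_le (uH t t0) (ltW b0)).
  apply: (@le_trans _ _ (M%:E * H1norm u0)%E).
    by apply: le_trans bnd; apply: ereal_sup_ubound; exists t.
  by rewrite -mulrA EFinM lee_wpmul2l// lee_fin ltW.
have uae t : 0 <= t -> \forall x \ae leb, normc (u t x) <= 4 * (M * c) * eps.
  move=> t0; have [n1 n1'] := un t t0.
  by apply: ae_imply (ae_normc_le_sobolev (uH t t0)) => x /le_trans; apply; lra.
have Le0 : 0 <= L * eps ^+ 2 by rewrite mulr_ge0 ?sqr_ge0// ltW.
have normN z : normc z <= 4 * (M * c) * eps -> normc (N z) <= L * eps ^+ 2 * normc z.
  move=> zle; have := lipN z 0 zle; rewrite N0 !subr0; apply.
  by rewrite Normc.normc0; lra.
have sN t : 0 <= t -> csqintegrable (fun x => N (u t x)).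
  move=> t0; have [u2 _ _] := uH t t0; have [m1 m2] := mN _ u2.
  by apply: (csqintegrable_ae_le m1 m2 u2 Le0); apply: ae_imply (uae t t0) => x /normN.
have e3 : eps ^+ 3 = eps ^+ 2 * eps by ring.
split.
- exact: global_H1_solution_flow sol sN.
- move=> t t0; have [u2 _ _] := uH t t0; have [n1 _] := un t t0.
  apply: (@le_trans _ _ (L * eps ^+ 2 * cnorm (u t))).
    by apply: le_cnorm => //; [exact: sN|apply: ae_imply (uae t t0) => x /normN].
  have -> : L * (M * c) * eps ^+ 3 = L * eps ^+ 2 * (M * c * eps) by rewrite e3; ring.
  exact: ler_wpM2l.
- move=> t h t0 h0; have [u2 _ _] := uH t t0; have [_ n1] := un t t0.
  have u2h := csqintegrable_shift h u2.
  apply: (@le_trans _ _ (L * eps ^+ 2 * cnorm ((fun x => u t (x + h)) \- u t))).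
    apply: le_cnorm => //.
    + by apply: csqintegrableB; [exact: (csqintegrable_shift h (sN t t0))|exact: sN].
    + exact: csqintegrableB.
    + by apply: ae_imply2 (uae t t0) (ae_shift h (uae t t0)) => x h1 h2; exact: lipN.
  have -> : h * (L * (M * c) * eps ^+ 3) = L * eps ^+ 2 * (h * (M * c * eps)) by rewrite e3; ring.
  apply: ler_wpM2l => //; apply: (le_trans (cnorm_translate_sub_le (uH t t0) h0)).
  exact: ler_wpM2l.
Qed.

(** The initial value enters through its increments rather than through [dw 0], because their norms
    do not change when [w 0] is replaced by an almost everywhere equal function. *)
Lemma schroedinger_flow_derivative_le nu w dw f B C t :
  schroedinger_flow nu w dw f -> 0 <= nu ->
  0 <= B -> 0 <= C -> 0 <= t ->
  (forall s h, 0 <= s -> 0 <= h -> cnorm ((fun x => f s (x + h)) \- f s) <= h * B) ->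
  (forall h, 0 <= h -> cnorm ((fun x => w 0 (x + h)) \- w 0) <= h * C) ->
  cnorm (dw t) <= 2 * (C + t * B).
Proof.
move=> fl nu0 B0 C0 t0 fB wC; have [h1 _ _ _] := fl.
apply: (cnorm_weak_derivative_le (h1 t t0)); first by rewrite addr_ge0// mulr_ge0.
move=> n; set h := n.+1%:R^-1; have h0 : 0 <= h by rewrite invr_ge0.
have := schroedinger_flow_le (schroedinger_flowB (schroedinger_flow_shift h fl) fl) nu0
  (B := h * B) (fun s s0 => fB s h s0 h0) t0.
move=> /le_trans; apply; rewrite mulrDr lerD ?wC//.
by rewrite mulrCA.
Qed.

End closeness.

Section closeness_theorem.
Context {R : realType}.
Local Notation leb := (@lebesgue_measure R).
Local Notation normc := (@Normc.normc R).
Implicit Types (M nu L eps h t B C T : R).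

Variables (p K nu mu gamma c0 C0 M : R) (F : R -> R).
Hypotheses (p1 : 1 <= p) (K0 : 0 < K) (nu0 : 0 < nu) (mu0 : 0 < mu) (gamma0 : 0 < gamma).
Hypothesis F_lip : forall x y, 0 <= x -> 0 <= y ->
  `|F x - F y| <= K * (`|x| `^ (p - 1) + `|y| `^ (p - 1)) * `|x - y|.
Hypothesis F0 : F 0 = 0.
Hypothesis dF : forall x, 0 <= x -> derivable F x 1.
Hypotheses (c00 : 0 < c0) (C00 : 0 < C0) (M0 : 0 < M).

(** The cubic nonlinearity is [general_nonlinearity mu F] for [F] the identity, which satisfies the
    growth hypotheses with [p = 1] and [K = 1]. *)
Lemma cubic_forcing : exists2 B, 0 < B &
  forall eps (u0 : R -> R[i]) (u : R -> R -> R[i]), 0 < eps < 1 -> H1 u0 ->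
  (H1norm u0 <= (c0 * eps)%:E)%E ->
  bounded_global_H1_solution M nu (cubic_nonlinearity mu) u0 u ->
  exists f : R -> R -> R[i], [/\ schroedinger_flow nu u (fun t => Dx (u t)) f,
    forall t, 0 <= t -> cnorm (f t) <= B * eps ^+ 3 &
    forall t h, 0 <= t -> 0 <= h ->
      cnorm ((fun x => f t (x + h)) \- f t) <= h * (B * eps ^+ 3)].
Proof.
have id_lip (x y : R) : 0 <= x -> 0 <= y ->
    `|x - y| <= 1 * (`|x| `^ (1 - 1) + `|y| `^ (1 - 1)) * `|x - y|.
  by move=> _ _; rewrite subrr !powRr0; have := normr_ge0 (x - y); lra.
have m0 : 0 < 4 * (M * c0) by rewrite !mulr_gt0.
have [L [L0 lip]] := general_nonlinearity_lipschitz (F := id) (lexx 1) ltr01 mu0 id_lip erefl m0.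
exists (L * (M * c0)); first by rewrite !mulr_gt0.
move=> eps u0 u /andP[e0 e1] u0H1 u0le sol.
exists (fun t x => cubic_nonlinearity mu (u t x)).
apply: (bounded_solution_forcing M0 c00 L0 e0 _ _ _ u0H1 u0le sol).
- by rewrite /cubic_nonlinearity mulr0.
- by move=> v; apply: (measurable_general_nonlinearity mu (F := id)) => x _; exact: derivable_id.
- by move=> z z'; apply: lip; rewrite e0.
Qed.

Lemma general_forcing : exists2 B, 0 < B &
  forall eps (u0 : R -> R[i]) (u : R -> R -> R[i]), 0 < eps < 1 -> H1 u0 ->
  (H1norm u0 <= (C0 * eps)%:E)%E ->
  bounded_global_H1_solution M nu (general_nonlinearity gamma F) u0 u ->
  exists f : R -> R -> R[i], [/\ schroedinger_flow nu u (fun t => Dx (u t)) f,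
    forall t, 0 <= t -> cnorm (f t) <= B * eps ^+ 3 &
    forall t h, 0 <= t -> 0 <= h ->
      cnorm ((fun x => f t (x + h)) \- f t) <= h * (B * eps ^+ 3)].
Proof.
have m0 : 0 < 4 * (M * C0) by rewrite !mulr_gt0.
have [L [L0 lip]] := general_nonlinearity_lipschitz p1 K0 gamma0 F_lip F0 m0.
exists (L * (M * C0)); first by rewrite !mulr_gt0.
move=> eps u0 u /andP[e0 e1] u0H1 u0le sol.
exists (fun t x => general_nonlinearity gamma F (u t x)).
apply: (bounded_solution_forcing M0 C00 L0 e0 _ _ _ u0H1 u0le sol).
- by rewrite /general_nonlinearity mulr0.
- by move=> v; exact: measurable_general_nonlinearity.
- by move=> z z'; apply: lip; rewrite e0.
Qed.

(** The two forcings are estimated separately, so [B] is the sum of their constants. *)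
Lemma solution_difference : exists2 B, 0 < B &
  forall eps (u0 U0 : R -> R[i]) (u U : R -> R -> R[i]), 0 < eps < 1 ->
  H1 u0 -> H1 U0 ->
  (H1norm u0 <= (c0 * eps)%:E)%E -> (H1norm U0 <= (C0 * eps)%:E)%E ->
  bounded_global_H1_solution M nu (cubic_nonlinearity mu) u0 u ->
  bounded_global_H1_solution M nu (general_nonlinearity gamma F) U0 U ->
  [/\ forall t, 0 <= t -> H1_derivative (u t \- U t) (Dx (u t) \- Dx (U t)),
      forall t, 0 <= t -> cnorm (u t \- U t) <= cnorm (u0 \- U0) + t * (B * eps ^+ 3) &
      forall t, 0 <= t ->
        cnorm (Dx (u t) \- Dx (U t)) <= 2 * (cnorm (Dx (u0 \- U0)) + t * (B * eps ^+ 3))].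
Proof.
have [B1 B10 H1f] := cubic_forcing; have [B2 B20 H2f] := general_forcing.
exists (B1 + B2); first exact: addr_gt0.
move=> eps u0 U0 u U e01 u0H UH u0le U0le sol Sol.
have [f1 [fl1 n1 t1]] := H1f _ _ _ e01 u0H u0le sol.
have [f2 [fl2 n2' t2]] := H2f _ _ _ e01 UH U0le Sol.
have fl := schroedinger_flowB fl1 fl2.
have [h1 s1 _ _] := fl1; have [h2 s2 _ _] := fl2; have [h3 _ _ _] := fl.
have nu0' := ltW nu0.
have d0 := H1_derivativeB (H1_Dx u0H) (H1_Dx UH).
have d0' := H1_Dx (H1_derivative_H1 d0).
have [w02 _ _] := h3 0 (lexx 0); have [d02 _ _] := d0.
(* Solutions attain their data almost everywhere only, so bounds on [u0 \- U0] are transferred to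
   time 0 through norms. *)
have ae0 : \forall x \ae leb, (u 0 \- U 0) x = (u0 \- U0) x.
  case: sol => -[_ _ _ a1] _; case: Sol => -[_ _ _ a2] _.
  by apply: ae_imply2 a1 a2 => x /= -> ->.
have B0 : 0 <= (B1 + B2) * eps ^+ 3.
  by case/andP : e01 => e0 _; rewrite mulr_ge0 ?exprn_ge0 ?addr_ge0 ?ltW.
split=> //.
- move=> t t0; rewrite -(eq_ae_cnorm w02 d02 ae0).
  apply: (schroedinger_flow_le fl nu0') => // s s0.
  apply: (le_trans (cnormB (s1 s s0) (s2 s s0))).
  by rewrite mulrDl; apply: lerD; [exact: n1|exact: n2'].
- move=> t t0; apply: (schroedinger_flow_derivative_le fl nu0' B0 _ t0); first exact: cnorm_ge0.
  + move=> s h s0 h0.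
    have -> : (fun x => (f1 s \- f2 s) (x + h)) \- (f1 s \- f2 s) =
        ((fun x => f1 s (x + h)) \- f1 s) \- ((fun x => f2 s (x + h)) \- f2 s).
      by apply/funext => x /=; ring.
    have a1 := csqintegrable_shift h (s1 s s0); have a2 := csqintegrable_shift h (s2 s s0).
    apply: (le_trans (cnormB (csqintegrableB a1 (s1 s s0)) (csqintegrableB a2 (s2 s s0)))).
    by rewrite mulrDl mulrDr; apply: lerD; [exact: t1|exact: t2].
  + move=> h h0; rewrite (_ : cnorm _ = cnorm ((fun x => (u0 \- U0) (x + h)) \- (u0 \- U0))).
      exact: (cnorm_translate_sub_le d0' h0).
    apply: eq_ae_cnorm.
    * by apply: csqintegrableB => //; exact: (csqintegrable_shift h w02).
    * by apply: csqintegrableB => //; exact: (csqintegrable_shift h d02).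
    * by apply: ae_imply2 ae0 (ae_shift h ae0) => x /= -> ->.
Qed.

End closeness_theorem.

Theorem theorem2p2 (R : realType) (p K nu : R) (F : R -> R)
    (mu gamma c0 C0 Tf M : R) :
  1 <= p -> 0 < K -> 0 < nu -> 0 < mu -> 0 < gamma ->
  (forall x y, 0 <= x -> 0 <= y ->
     `|F x - F y| <= K * (`|x| `^ (p - 1) + `|y| `^ (p - 1)) * `|x - y|) ->
  F 0 = 0 ->
  (forall x, 0 <= x -> derivable F x 1 /\ `|derive1 F x| <= K * `|x| `^ (p - 1)) ->
  0 < c0 -> 0 < C0 -> 0 < Tf -> 0 < M ->
  (forall C : R, 0 < C ->
    exists Ct : R, 0 < Ct /\
    forall (eps : R) (u0 U0 : R -> R[i]) (u U : R -> R -> R[i]),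
      0 < eps < 1 ->
      H1 u0 -> H1 U0 ->
      (L2norm (u0 \- U0) <= (C * eps ^+ 3)%:E)%E ->
      (H1norm u0 <= (c0 * eps)%:E)%E ->
      (H1norm U0 <= (C0 * eps)%:E)%E ->
      bounded_global_H1_solution M nu (cubic_nonlinearity mu) u0 u ->
      bounded_global_H1_solution M nu (general_nonlinearity gamma F) U0 U ->
      (ereal_sup [set L2norm (u t \- U t) | t in [set t | (0 <= t <= Tf)%R]]
         <= (Ct * eps ^+ 3)%:E)%E)
  /\
  (forall C1 : R, 0 < C1 ->
    (exists C1t : R, 0 < C1t /\
     forall (eps : R) (u0 U0 : R -> R[i]) (u U : R -> R -> R[i]),
       0 < eps < 1 ->
       H1 u0 -> H1 U0 ->
       (H1norm (u0 \- U0) <= (C1 * eps ^+ 3)%:E)%E ->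
       (H1norm u0 <= (c0 * eps)%:E)%E ->
       (H1norm U0 <= (C0 * eps)%:E)%E ->
       bounded_global_H1_solution M nu (cubic_nonlinearity mu) u0 u ->
       bounded_global_H1_solution M nu (general_nonlinearity gamma F) U0 U ->
       (ereal_sup [set H1norm (u t \- U t) | t in [set t | (0 <= t <= Tf)%R]]
          <= (C1t * eps ^+ 3)%:E)%E)
    /\
    (exists C2t : R, 0 < C2t /\
     forall (eps : R) (u0 U0 : R -> R[i]) (u U : R -> R -> R[i]),
       0 < eps < 1 ->
       H1 u0 -> H1 U0 ->
       (H1norm (u0 \- U0) <= (C1 * eps ^+ 3)%:E)%E ->
       (H1norm u0 <= (c0 * eps)%:E)%E ->
       (H1norm U0 <= (C0 * eps)%:E)%E ->
       bounded_global_H1_solution M nu (cubic_nonlinearity mu) u0 u ->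
       bounded_global_H1_solution M nu (general_nonlinearity gamma F) U0 U ->
       (ereal_sup [set Linftynorm (u t \- U t) | t in [set t | (0 <= t <= Tf)%R]]
          <= (C2t * eps ^+ 3)%:E)%E)).
Proof.
move=> p1 K0 nu0 mu0 gamma0 F_lip F0 dF c00 C00 Tf0 M0.
have [B B0 H] := solution_difference p1 K0 nu0 mu0 gamma0 F_lip F0
  (fun x x0 => proj1 (dF x x0)) c00 C00 M0.
have TB0 : 0 < Tf * B by rewrite mulr_gt0.
have growth (eps t : R) : 0 < eps < 1 -> 0 <= t <= Tf -> t * (B * eps ^+ 3) <= Tf * B * eps ^+ 3.
  move=> /andP[e0 _] /andP[_ tT]; rewrite mulrA.
  apply: ler_wpM2r; first exact: exprn_ge0 (ltW e0).
  by apply: ler_wpM2r => //; exact: ltW.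
split=> [C Cpos|C Cpos].
  exists (C + Tf * B); split; first exact: addr_gt0.
  move=> eps u0 U0 u U e01 u0H UH dif u0le U0le sol Sol.
  have [d1 d2 _] := H _ _ _ _ _ e01 u0H UH u0le U0le sol Sol.
  have [s0 _ _] := H1_derivativeB (H1_Dx u0H) (H1_Dx UH).
  move: dif; rewrite L2normE// lee_fin => dif.
  apply: ub_ereal_sup => _ [t t0T <-].
  have [t0 tT] := andP t0T; have [st _ _] := d1 t t0.
  rewrite L2normE// lee_fin mulrDl; apply: (le_trans (d2 t t0)).
  by rewrite lerD// growth.
pose D := C + Tf * B.
have D0 : 0 < D by exact: addr_gt0.
(* Shared by the H^1 and the supremum bounds; the factor 2 on the derivative comes from
   [cnorm_weak_derivative_le]. *)
have key eps (u0 U0 : R -> R[i]) (u U : R -> R -> R[i]) t :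
    0 < eps < 1 -> H1 u0 -> H1 U0 ->
    (H1norm (u0 \- U0) <= (C * eps ^+ 3)%:E)%E ->
    (H1norm u0 <= (c0 * eps)%:E)%E -> (H1norm U0 <= (C0 * eps)%:E)%E ->
    bounded_global_H1_solution M nu (cubic_nonlinearity mu) u0 u ->
    bounded_global_H1_solution M nu (general_nonlinearity gamma F) U0 U ->
    0 <= t <= Tf ->
    [/\ H1_derivative (u t \- U t) (Dx (u t) \- Dx (U t)),
        cnorm (u t \- U t) <= D * eps ^+ 3 & cnorm (Dx (u t) \- Dx (U t)) <= 2 * D * eps ^+ 3].
  move=> e01 u0H UH dif u0le U0le sol Sol t0T.
  have [t0 tT] := andP t0T; have [e0 _] := andP e01.
  have [d1 d2 d3] := H _ _ _ _ _ e01 u0H UH u0le U0le sol Sol.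
  have d0 := H1_Dx (H1_derivative_H1 (H1_derivativeB (H1_Dx u0H) (H1_Dx UH))).
  have Ce : 0 <= C * eps ^+ 3 by rewrite mulr_ge0 ?exprn_ge0// ltW.
  have [b1 b2] := H1norm_le d0 Ce dif.
  have g := growth eps t e01 t0T.
  split; first exact: d1.
    by apply: (le_trans (d2 t t0)); rewrite /D mulrDl lerD.
  apply: (le_trans (d3 t t0)); rewrite -mulrA ler_wpM2l//.
  by rewrite /D mulrDl lerD.
split.
  (* The sum of [D] for the difference and [2 * D] for its derivative. *)
  exists (3 * D); split; first by rewrite mulr_gt0.
  move=> eps u0 U0 u U e01 u0H UH dif u0le U0le sol Sol.
  apply: ub_ereal_sup => _ [t t0T <-].
  have [d a b] := key _ _ _ _ _ _ e01 u0H UH dif u0le U0le sol Sol t0T.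
  have -> : 3 * D * eps ^+ 3 = D * eps ^+ 3 + 2 * D * eps ^+ 3 by ring.
  exact: (H1norm_ge d a b).
(* The Sobolev constant 2 times the same sum [D + 2 * D]. *)
exists (6 * D); split; first by rewrite mulr_gt0.
move=> eps u0 U0 u U e01 u0H UH dif u0le U0le sol Sol.
have [e0 _] := andP e01.
apply: ub_ereal_sup => _ [t t0T <-].
have [d a b] := key _ _ _ _ _ _ e01 u0H UH dif u0le U0le sol Sol t0T.
apply: Linftynorm_le; last by rewrite mulr_ge0 ?exprn_ge0 ?mulr_ge0 ?(ltW D0) ?(ltW e0).
have -> : 6 * D * eps ^+ 3 = 2 * (D * eps ^+ 3 + 2 * D * eps ^+ 3) by ring.
apply: ae_imply (ae_normc_le_sobolev d) => x /le_trans; apply.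
by rewrite ler_wpM2l// lerD.
Qed.
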